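(* For all positive integers $m$ and $p$, $$(-1)^m \sum_{j=1}^p W(2j+2m-1,2m)\,Z(j,p)=(-1)^p \sum_{j=1}^m W(2j+2p-1,2p)\,Z(j,m).$$
   Context: For positive integers $k_1,\dots,k_r$ the alternating multiple $T$-value is $\bar T(k_1,\ldots,k_r):=2^r\sum_{0<n_1<\cdots<n_r}\frac{(-1)^{n_r}}{(2n_1-1)^{k_1}(2n_2-2)^{k_2}\cdots(2n_r-r)^{k_r}}$ (conditionally convergent series), with $\bar T(\emptyset):=1$. $I(k,r)$ denotes the set of tuples $(k_1,\dots,k_r)$ of positive integers with $k_1+\cdots+k_r=k$. For a positive integer $m$, $W_m(k,r):=\sum_{(k_1,\dots,k_r)\in I(k,r)}\binom{k_r+m-2}{m-1}\bar T(k_1,\ldots,k_{r-1},k_r+m-1)$, and $W(k,r):=W_1(k,r)=\sum_{(k_1,\dots,k_r)\in I(k,r)}\bar T(k_1,\dots,k_r)$. $\bar\zeta(s):=\sum_{n\ge1}(-1)^{n-1}n^{-s}$ for integers $s\ge1$, and $\bar\zeta(0):=1/2$. For integers $1\le j\le p$: $Z(p,p):=1$ and, for $j<p$, $Z(j,p):=\sum_{k=1}^{p-j}(-2)^k\sum_{j=i_0<i_1<\cdots<i_{k-1}<i_k=p}\ \prod_{l=1}^k\bar\zeta(2i_l-2i_{l-1})$ (inner sum over integers $i_1<\dots<i_{k-1}$ strictly between $j$ and $p$). *)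

(* Defs.v *)
From Stdlib Require Import Reals List Arith.
From Coquelicot Require Import Coquelicot.
Import ListNotations.
Open Scope R_scope.

Definition Rsum_list (l : list R) : R := fold_right Rplus 0 l.

Fixpoint incr_lists (len lo hi : nat) : list (list nat) :=
  match len with
  | O => [ [] ]
  | S l => flat_map (fun a => map (cons a) (incr_lists l (S a) hi))
                    (seq lo (S hi - lo))
  end.

Fixpoint compositions (r k : nat) : list (list nat) :=
  match r with
  | O => if Nat.eqb k 0 then [ [] ] else []
  | S r' => flat_map (fun a => map (cons a) (compositions r' (k - a)))
                     (seq 1 k)
  end.

Fixpoint Tbar_prod (i0 : nat) (ks ns : list nat) : R :=
  match ks, ns with
  | k :: ks', n :: ns' =>
      / (2 * INR n - INR i0) ^ k * Tbar_prod (S i0) ks' ns'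
  | _, _ => 1
  end.

Definition Tbar_partial (ks : list nat) (N : nat) : R :=
  2 ^ length ks *
  Rsum_list (map (fun ns => (-1) ^ (last ns O) * Tbar_prod 1 ks ns)
                 (incr_lists (length ks) 1 N)).

(* alternating multiple T-value (value of the conditionally convergent series,
   summed with outer index n_r; Tbar(empty) = 1) *)
Definition Tbar (ks : list nat) : R :=
  match ks with
  | [] => 1
  | _ => real (Lim_seq (Tbar_partial ks))
  end.

Definition W (k r : nat) : R := Rsum_list (map Tbar (compositions r k)).

Definition zetabar (s : nat) : R :=
  match s with
  | O => / 2
  | _ => real (Lim_seq (fun N =>
           Rsum_list (map (fun n => (-1) ^ (n - 1) / INR n ^ s) (seq 1 N))))
  end.

Fixpoint chain_prod (prev : nat) (l : list nat) : R :=
  match l with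
  | [] => 1
  | x :: l' => zetabar (2 * x - 2 * prev) * chain_prod x l'
  end.

Definition Zjp (j p : nat) : R :=
  if Nat.eqb j p then 1
  else Rsum_list (map (fun k =>
         (-2) ^ k *
         Rsum_list (map (fun mids => chain_prod j (mids ++ [p]))
                        (incr_lists (k - 1) (S j) (p - 1))))
       (seq 1 (p - j))).

(* W_m(k,r) = sum_{I(k,r)} binom(k_r+m-2, m-1) Tbar(k_1,..,k_{r-1},k_r+m-1)
   (general version, not needed for the statement since W = W_1) *)
Definition W_m (m k r : nat) : R :=
  Rsum_list (map (fun ks =>
     let kr := last ks O in
     Binomial.C (kr + m - 2) (m - 1) *
     Tbar (removelast ks ++ [kr + m - 1]%nat)) (compositions r k)).

(* Main.v *)
Require Import Defs.
From Stdlib Require Import Reals List Arith Lra Lia.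
From Coquelicot Require Import Coquelicot.
Import ListNotations.
Open Scope R_scope.

(** Let [v = gd w] be the Gudermannian function, so that [dv = dw / cosh w].  Shuffling the iterated
    integrals of the [T]-values turns [W (A + B) B] into [(-1)^B] times the integral over [w > 0]
    of [w^A / A! * v^(B-1) / (B-1)! dv].  The numbers [Z(j,p)] are the Taylor coefficients of
    [sin (pi x) / (pi x)]; hence [(-1)^(m-1) v^(2m-1) / (2m-1)!] is the combination with
    coefficients [Z(i,m)] of the Fourier series [2 sum_n (-1)^(n-1) sin (n v) / n^(2i-1)].  By the
    Poisson kernel the [i]-th series is [cosh w] times the integral over [t > 0] of
    [t^(2i-1) / (2i-1)! * kappa t w], where [kappa t w = sinh t sinh w / (cosh t cosh w + 1)^2] is
    symmetric.  So the left-hand side is minus the sum over [i <= m], [j <= p] of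
    [Z(i,m) Z(j,p)] times the double moments of [kappa], and Fubini makes it symmetric.
    Truncating all integrals and series at the same [N] reduces Fubini to a square. *)

(** * Finite sums *)

Notation "\sum_ ( x <- l ) F" := (Rsum_list (map (fun x => F) l))
  (at level 41, F at level 41, x, l at level 50) : R_scope.
Notation "\sum_ ( i < n ) F" := (Rsum_list (map (fun i => F) (seq 0 n)))
  (at level 41, F at level 41, i, n at level 50) : R_scope.

Lemma Rsum_nil {T} (f : T -> R) : \sum_(x <- []) f x = 0.
Proof. reflexivity. Qed.

Lemma Rsum_cons {T} (f : T -> R) a l : \sum_(x <- a :: l) f x = f a + \sum_(x <- l) f x.
Proof. reflexivity. Qed.

Lemma Rsum_app {T} (f : T -> R) l1 l2 :
  \sum_(x <- l1 ++ l2) f x = \sum_(x <- l1) f x + \sum_(x <- l2) f x.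
Proof.
  induction l1 as [|a l1 IH]; [simpl; ring|].
  rewrite <- app_comm_cons, !Rsum_cons, IH; ring.
Qed.

Lemma Rsum_ext {T} (f g : T -> R) l :
  (forall x, In x l -> f x = g x) -> \sum_(x <- l) f x = \sum_(x <- l) g x.
Proof. intros H; f_equal; now apply map_ext_in. Qed.

Lemma Rsum_ext_lt (f g : nat -> R) n :
  (forall i, (i < n)%nat -> f i = g i) -> \sum_(i < n) f i = \sum_(i < n) g i.
Proof. intros H; apply Rsum_ext; intros i Hi; apply in_seq in Hi; apply H; lia. Qed.

Lemma Rsum_plus {T} (f g : T -> R) l :
  \sum_(x <- l) (f x + g x) = \sum_(x <- l) f x + \sum_(x <- l) g x.
Proof. induction l as [|a l IH]; [simpl; ring|]. rewrite !Rsum_cons, IH; ring. Qed.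

Lemma Rsum_scal {T} c (f : T -> R) l : \sum_(x <- l) (c * f x) = c * \sum_(x <- l) f x.
Proof. induction l as [|a l IH]; [simpl; ring|]. rewrite !Rsum_cons, IH; ring. Qed.

Lemma Rsum_opp {T} (f : T -> R) l : \sum_(x <- l) (- f x) = - \sum_(x <- l) f x.
Proof. induction l as [|a l IH]; [simpl; ring|]. rewrite !Rsum_cons, IH; ring. Qed.

Lemma Rsum_minus {T} (f g : T -> R) l :
  \sum_(x <- l) (f x - g x) = \sum_(x <- l) f x - \sum_(x <- l) g x.
Proof. induction l as [|a l IH]; [simpl; ring|]. rewrite !Rsum_cons, IH; ring. Qed.

Lemma Rsum_eq_0 {T} (f : T -> R) l : (forall x, In x l -> f x = 0) -> \sum_(x <- l) f x = 0.
Proof.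
  induction l as [|a l IH]; intros H; [reflexivity|].
  rewrite Rsum_cons, (H a) by now left. rewrite IH by (intros; apply H; now right); ring.
Qed.

Lemma Rsum_le {T} (f g : T -> R) l :
  (forall x, In x l -> f x <= g x) -> \sum_(x <- l) f x <= \sum_(x <- l) g x.
Proof.
  induction l as [|a l IH]; intros H; [apply Rle_refl|].
  rewrite !Rsum_cons; apply Rplus_le_compat; [apply H; now left|].
  apply IH; intros; apply H; now right.
Qed.

Lemma Rsum_nonneg {T} (f : T -> R) l : (forall x, In x l -> 0 <= f x) -> 0 <= \sum_(x <- l) f x.
Proof. intros H; rewrite <- (Rsum_eq_0 (fun _ => 0) l); [now apply Rsum_le|reflexivity]. Qed.

Lemma Rabs_Rsum_le {T} (f : T -> R) l : Rabs (\sum_(x <- l) f x) <= \sum_(x <- l) Rabs (f x).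
Proof.
  induction l as [|a l IH]; [simpl; rewrite Rabs_R0; apply Rle_refl|].
  rewrite !Rsum_cons; eapply Rle_trans; [apply Rabs_triang|lra].
Qed.

Lemma Rsum_exchange {T U} (f : T -> U -> R) l m :
  \sum_(x <- l) \sum_(y <- m) f x y = \sum_(y <- m) \sum_(x <- l) f x y.
Proof.
  induction l as [|a l IH].
  - symmetry; now apply Rsum_eq_0.
  - rewrite Rsum_cons, IH, <- Rsum_plus; reflexivity.
Qed.

Lemma Rsum_flat_map {T U} (f : U -> R) (g : T -> list U) l :
  \sum_(y <- flat_map g l) f y = \sum_(x <- l) \sum_(y <- g x) f y.
Proof.
  induction l as [|a l IH]; [reflexivity|]. simpl flat_map; now rewrite Rsum_app, IH.
Qed.

Lemma Rsum_seq (f : nat -> R) a n : \sum_(x <- seq a n) f x = \sum_(i < n) f (a + i)%nat.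
Proof.
  induction n as [|n IH]; [reflexivity|]. rewrite !seq_S, !Rsum_app, IH; reflexivity.
Qed.

Lemma Rsum_S (f : nat -> R) n : \sum_(i < S n) f i = \sum_(i < n) f i + f n.
Proof. rewrite seq_S, Rsum_app, Rsum_cons, Rsum_nil, Rplus_0_r; reflexivity. Qed.

Lemma Rsum_1 (f : nat -> R) : \sum_(i < 1) f i = f 0%nat.
Proof. apply Rplus_0_r. Qed.

Lemma Rsum_S_first (f : nat -> R) n : \sum_(i < S n) f i = f 0%nat + \sum_(i < n) f (S i).
Proof. cbn [seq]; rewrite Rsum_cons, Rsum_seq; reflexivity. Qed.

Lemma Rsum_const c n : \sum_(i < n) c = INR n * c.
Proof. induction n as [|n IH]; [simpl; ring|]. rewrite Rsum_S, IH, S_INR; ring. Qed.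

Lemma Rsum_telescope (f : nat -> R) n : \sum_(i < n) (f (S i) - f i) = f n - f 0%nat.
Proof. induction n as [|n IH]; [simpl; ring|]. rewrite Rsum_S, IH; ring. Qed.

Lemma Rsum_by_parts (f x : nat -> R) n :
  \sum_(i < n) (f i - f (S i)) * x i =
  f 0%nat * x 0%nat + \sum_(i < n) f (S i) * (x (S i) - x i) - f n * x n.
Proof. induction n as [|n IH]; [simpl; ring|]. rewrite !Rsum_S, IH; ring. Qed.

Lemma Rsum_extend (f : nat -> R) n m : (n <= m)%nat ->
  (forall i, (n <= i < m)%nat -> f i = 0) -> \sum_(i < m) f i = \sum_(i < n) f i.
Proof.
  intros Hnm H. replace m with (n + (m - n))%nat by lia.
  rewrite seq_app, Rsum_app, (Rsum_eq_0 _ (seq (0 + n) (m - n))); [apply Rplus_0_r|].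
  intros i Hi; apply in_seq in Hi; apply H; lia.
Qed.

Lemma Rsum_triangle (f : nat -> nat -> R) n :
  \sum_(i < n) \sum_(j < n - S i) f i j = \sum_(j < n) \sum_(i < n - S j) f i j.
Proof.
  assert (Hsquare : forall g : nat -> nat -> R, \sum_(i < n) \sum_(j < n - S i) g i j =
     \sum_(i < n) \sum_(j < n) if (S i + j <? n)%nat then g i j else 0).
  { intros g; apply Rsum_ext_lt; intros i Hi.
    rewrite (Rsum_extend _ (n - S i) n); [|lia|].
    - apply Rsum_ext_lt; intros j Hj; destruct (Nat.ltb_spec (S i + j) n); [reflexivity|lia].
    - intros j Hj; destruct (Nat.ltb_spec (S i + j) n); [lia|reflexivity]. }
  rewrite Hsquare, (Hsquare (fun j i => f i j)), Rsum_exchange.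
  apply Rsum_ext; intros j _; apply Rsum_ext; intros i _.
  now rewrite (Nat.add_succ_comm i j), (Nat.add_comm i (S j)).
Qed.

Lemma is_lim_seq_Rsum {T} (u : T -> nat -> R) (v : T -> R) l :
  (forall x, In x l -> is_lim_seq (u x) (v x)) ->
  is_lim_seq (fun N => \sum_(x <- l) u x N) (\sum_(x <- l) v x).
Proof.
  induction l as [|a l IH]; intros H; [apply is_lim_seq_const|].
  apply (is_lim_seq_plus' (u a) _ (v a)); [apply H; now left|].
  apply IH; intros; apply H; now right.
Qed.

Lemma is_derive_Rsum {T} (f : T -> R -> R) (df : T -> R) l y :
  (forall x, is_derive (f x) y (df x)) ->
  is_derive (fun z => \sum_(x <- l) f x z) y (\sum_(x <- l) df x).
Proof.
  intros H; induction l as [|a l IH]; [apply (is_derive_const 0)|].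
  now apply (is_derive_plus (f a) (fun z => \sum_(x <- l) f x z)).
Qed.

Lemma continuous_Rsum {T} {U : UniformSpace} (f : T -> U -> R) l y :
  (forall x, continuous (f x) y) -> continuous (fun z => \sum_(x <- l) f x z) y.
Proof.
  intros H; induction l as [|a l IH]; [apply continuous_const|].
  now apply (continuous_plus (V := R_NormedModule) (f a) (fun z => \sum_(x <- l) f x z)).
Qed.

Lemma is_RInt_Rsum {T} (f : T -> R -> R) (If : T -> R) l a b :
  (forall x, is_RInt (f x) a b (If x)) ->
  is_RInt (fun y => \sum_(x <- l) f x y) a b (\sum_(x <- l) If x).
Proof.
  intros H; induction l as [|c l IH].
  - replace (\sum_(x <- []) If x) with (scal (b - a) 0) by apply Rmult_0_r.
    apply (is_RInt_const (V := R_NormedModule) a b 0).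
  - now apply (is_RInt_plus (V := R_NormedModule) (f c) (fun y => \sum_(x <- l) f x y)).
Qed.

Lemma Rsum_bounded {T Y} (P : Y -> Prop) (f : T -> Y -> R) (g : Y -> R) l :
  (forall x, In x l -> exists C, 0 <= C /\ forall y, P y -> f x y <= C * g y) ->
  exists C, 0 <= C /\ forall y, P y -> \sum_(x <- l) f x y <= C * g y.
Proof.
  induction l as [|a l IH]; intros H.
  - exists 0; split; [lra|intros y _; rewrite Rsum_nil; lra].
  - destruct (H a) as [C [HC0 HC]]; [now left|].
    destruct IH as [D [HD0 HD]]; [intros; apply H; now right|].
    exists (C + D); split; [lra|intros y Hy]; rewrite Rsum_cons, Rmult_plus_distr_r.
    apply Rplus_le_compat; auto.
Qed.

(** * Calculus on the real line *)

Lemma is_derive_Rplus (f g : R -> R) x df dg :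
  is_derive f x df -> is_derive g x dg -> is_derive (fun y => f y + g y) x (df + dg).
Proof. exact (is_derive_plus (V := R_NormedModule) f g x df dg). Qed.

Lemma is_derive_Rminus (f g : R -> R) x df dg :
  is_derive f x df -> is_derive g x dg -> is_derive (fun y => f y - g y) x (df - dg).
Proof. exact (is_derive_minus (V := R_NormedModule) f g x df dg). Qed.

Lemma is_derive_Rmult (f g : R -> R) x df dg :
  is_derive f x df -> is_derive g x dg ->
  is_derive (fun y => f y * g y) x (df * g x + f x * dg).
Proof. intros Hf Hg; exact (is_derive_mult f g x df dg Hf Hg Rmult_comm). Qed.

Lemma Rabs_diff_le_of_is_derive (f f' : R -> R) K a b :
  (forall x, Rmin a b <= x <= Rmax a b -> is_derive f x (f' x)) ->
  (forall x, Rmin a b <= x <= Rmax a b -> Rabs (f' x) <= K) ->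
  Rabs (f b - f a) <= K * Rabs (b - a).
Proof.
  intros Hd HK. destruct (MVT_abs f f' a b) as [x [-> Hx]].
  - intros x Hx; now apply is_derive_Reals, Hd.
  - apply Rmult_le_compat_r; [apply Rabs_pos|auto].
Qed.

Lemma continuous_Rplus {U : UniformSpace} (f g : U -> R) x :
  continuous f x -> continuous g x -> continuous (fun y => f y + g y) x.
Proof. exact (continuous_plus (V := R_NormedModule) f g x). Qed.

Lemma continuous_Rminus {U : UniformSpace} (f g : U -> R) x :
  continuous f x -> continuous g x -> continuous (fun y => f y - g y) x.
Proof. exact (continuous_minus (V := R_NormedModule) f g x). Qed.

Lemma continuous_Rmult {U : UniformSpace} (f g : U -> R) x :
  continuous f x -> continuous g x -> continuous (fun y => f y * g y) x.
Proof. exact (continuous_mult (K := R_AbsRing) f g x). Qed.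

Lemma continuous_comp_is_derive {U : UniformSpace} (g : R -> R) (f : U -> R) x l :
  is_derive g (f x) l -> continuous f x -> continuous (fun y => g (f y)) x.
Proof.
  intros Hg Hf; apply continuous_comp; [assumption|].
  apply (ex_derive_continuous g); now exists l.
Qed.

Lemma continuous_Rinv_pos {U : UniformSpace} (f : U -> R) x :
  0 < f x -> continuous f x -> continuous (fun y => / f y) x.
Proof.
  intros Hpos Hf; apply continuous_comp; [assumption|]. apply continuous_Rinv; lra.
Qed.

Lemma continuous_exp_comp {U : UniformSpace} (f : U -> R) x :
  continuous f x -> continuous (fun y => exp (f y)) x.
Proof. apply continuous_comp_is_derive with (exp (f x)), is_derive_exp. Qed.

Create HintDb continuity.
#[local] Hint Resolve continuous_const continuous_id continuous_fst continuous_snd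
  continuous_Rplus continuous_Rminus continuous_Rmult continuous_Rinv_pos continuous_exp_comp
  continuous_Rsum : continuity.

Section ContinuousIntegrand.

Variable f : R -> R.
Hypothesis Hf : forall x, continuous f x.

Lemma ex_RInt_of_continuous a b : ex_RInt f a b.
Proof. now apply (ex_RInt_continuous (V := R_CompleteNormedModule)). Qed.

Lemma RInt_Rscal c a b : RInt (fun x => c * f x) a b = c * RInt f a b.
Proof. apply (RInt_scal (V := R_CompleteNormedModule) f), ex_RInt_of_continuous. Qed.

Lemma RInt_of_is_derive (F : R -> R) a b :
  (forall x, is_derive F x (f x)) -> RInt f a b = F b - F a.
Proof.
  intros HF; apply is_RInt_unique, (is_RInt_derive (V := R_CompleteNormedModule) F); auto.
Qed.

Lemma RInt_abs_le_exp K lam T : 0 < lam -> 0 <= T ->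
  (forall x, 0 <= x <= T -> Rabs (f x) <= K * exp (- lam * x)) ->
  Rabs (RInt f 0 T) <= K / lam.
Proof.
  intros Hlam HT Hb.
  assert (HK : 0 <= K).
  { specialize (Hb 0 (conj (Rle_refl 0) HT)); rewrite Rmult_0_r, exp_0, Rmult_1_r in Hb.
    eapply Rle_trans; [apply Rabs_pos|eassumption]. }
  apply Rle_trans with (RInt (fun x => K * exp (- lam * x)) 0 T).
  - eapply Rle_trans; [apply abs_RInt_le; [assumption|apply ex_RInt_of_continuous]|].
    apply RInt_le; [assumption| | |intros; apply Hb; lra];
      apply (ex_RInt_continuous (V := R_CompleteNormedModule)); intros x _;
      [now apply continuous_Rabs_comp|auto with continuity].
  - rewrite (is_RInt_unique _ _ _ (- K / lam * exp (- lam * T) - - K / lam * exp (- lam * 0))).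
    + rewrite Rmult_0_r, exp_0. assert (Hexp := exp_pos (- lam * T)).
      assert (0 <= K / lam) by now apply Rle_mult_inv_pos. unfold Rdiv in *; nra.
    + apply (is_RInt_derive (V := R_CompleteNormedModule) (fun x => - K / lam * exp (- lam * x))).
      * intros x _; auto_derive; [trivial|field; lra].
      * intros; auto with continuity.
Qed.

End ContinuousIntegrand.

Lemma RInt_Rminus f g a b : (forall x, continuous f x) -> (forall x, continuous g x) ->
  RInt (fun x => f x - g x) a b = RInt f a b - RInt g a b.
Proof.
  intros; apply (RInt_minus (V := R_CompleteNormedModule) f g); now apply ex_RInt_of_continuous.
Qed.

Lemma RInt_Rsum {T} (f : T -> R -> R) l a b : (forall x y, continuous (f x) y) ->
  RInt (fun y => \sum_(x <- l) f x y) a b = \sum_(x <- l) RInt (f x) a b.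
Proof.
  intros H; apply is_RInt_unique, is_RInt_Rsum; intros x.
  apply (RInt_correct (V := R_CompleteNormedModule)); now apply ex_RInt_of_continuous.
Qed.

Definition continuous2 (f : R -> R -> R) : Prop :=
  forall x y, continuous (fun z : R * R => f (fst z) (snd z)) (x, y).

Lemma continuous2_flip f : continuous2 f -> continuous2 (fun x y => f y x).
Proof.
  intros Hf x y. apply (continuous_comp_2 snd fst f);
    [apply continuous_snd|apply continuous_fst|apply Hf].
Qed.

Lemma continuous2_continuity_2d_pt f : continuous2 f -> forall x y, continuity_2d_pt f x y.
Proof. intros Hf x y; apply continuity_2d_pt_filterlim, Hf. Qed.

Lemma continuous2_r f x : continuous2 f -> forall y, continuous (f x) y.
Proof.
  intros Hf y. apply (continuous_comp_2 (fun _ => x) (fun y => y) f);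
    [apply continuous_const|apply continuous_id|apply Hf].
Qed.

Lemma continuous_RInt_param f a b c : continuous2 f -> continuous (fun x => RInt (f x) a b) c.
Proof.
  intros Hf; apply filterlim_locally; intros eps.
  assert (Hlen := Rabs_pos (b - a)).
  assert (He : 0 < eps / (Rabs (b - a) + 1)) by (apply Rdiv_lt_0_compat; [apply cond_pos|lra]).
  destruct (uniform_continuity_2d_1d' f (Rmin a b) (Rmax a b) c
    (fun y _ => continuous2_continuity_2d_pt f Hf c y) (mkposreal _ He)) as [d Hd].
  exists d; intros x Hx; simpl in Hd; change (Rabs (x - c) < d) in Hx.
  change (Rabs (RInt (f x) a b - RInt (f c) a b) < eps).
  rewrite <- RInt_Rminus by now apply continuous2_r.
  apply Rle_lt_trans with (Rabs (b - a) * (eps / (Rabs (b - a) + 1))).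
  - apply (norm_RInt_le_const_abs (V := R_NormedModule) (fun y => f x y - f c y)).
    + intros y Hy; apply Rlt_le, (Hd y c y x); try lra.
      * assert (Hdpos := cond_pos d); lra.
      * apply Rabs_def2 in Hx; lra.
      * rewrite Rminus_diag, Rabs_R0; apply cond_pos.
    + apply (RInt_correct (V := R_CompleteNormedModule)), ex_RInt_of_continuous.
      intros y; apply continuous_Rminus; now apply continuous2_r.
  - assert (Heps := cond_pos eps).
    apply Rmult_lt_reg_r with (Rabs (b - a) + 1); [lra|].
    replace (Rabs (b - a) * (eps / (Rabs (b - a) + 1)) * (Rabs (b - a) + 1))
      with (Rabs (b - a) * eps) by (field; lra). lra.
Qed.

Lemma is_derive_RInt_upper (f : R -> R) a x : (forall y, continuous f y) ->
  is_derive (fun s => RInt f a s) x (f x).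
Proof.
  intros Hf; apply (is_derive_RInt f _ a); [|apply Hf].
  apply filter_forall; intros s; apply (RInt_correct (V := R_CompleteNormedModule)).
  now apply ex_RInt_of_continuous.
Qed.

Lemma is_derive_iterated_RInt f a c d s : continuous2 f ->
  is_derive (fun s => RInt (fun y => RInt (fun x => f x y) a s) c d) s (RInt (f s) c d).
Proof.
  intros Hf; assert (Hf' := continuous2_flip f Hf).
  assert (Hinner : forall s y, is_derive (fun s => RInt (fun x => f x y) a s) s (f s y)).
  { intros s' y; apply (is_derive_RInt_upper (fun x => f x y)).
    apply (continuous2_r (fun y x => f x y) y Hf'). }
  rewrite <- (RInt_ext (fun y => Derive (fun u => RInt (fun x => f x y) a u) s))
    by (intros; now apply is_derive_unique).
  apply is_derive_RInt_param.
  - apply filter_forall; intros x y _; eexists; apply Hinner.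
  - intros y _; apply continuity_2d_pt_ext with f; [|now apply continuous2_continuity_2d_pt].
    intros u v; symmetry; now apply is_derive_unique.
  - apply filter_forall; intros u; apply ex_RInt_of_continuous; intros y.
    exact (continuous_RInt_param (fun y x => f x y) a u y Hf').
Qed.

(* Both sides vanish at [b = a] and have derivative [RInt (f b) c d] in [b]. *)
Lemma RInt_fubini f a b c d : continuous2 f ->
  RInt (fun x => RInt (fun y => f x y) c d) a b = RInt (fun y => RInt (fun x => f x y) a b) c d.
Proof.
  intros Hf.
  etransitivity; [exact (RInt_of_is_derive _ (fun x => continuous_RInt_param f c d x Hf) _ a b
    (fun s => is_derive_iterated_RInt f a c d s Hf))|].
  cbv beta; rewrite (RInt_ext (fun y => RInt (fun x => f x y) a a) (fun _ => 0))
    by (intros; apply (RInt_point (V := R_CompleteNormedModule))).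
  rewrite RInt_const; unfold scal; simpl; unfold mult; simpl; ring.
Qed.

(** * Null sequences and uniform convergence to zero *)

Lemma is_lim_seq_null_plus (u v : nat -> R) :
  is_lim_seq u 0 -> is_lim_seq v 0 -> is_lim_seq (fun n => u n + v n) 0.
Proof. intros Hu Hv; rewrite <- (Rplus_0_r 0); now apply is_lim_seq_plus'. Qed.

Lemma is_lim_seq_null_scal (c : R) (u : nat -> R) :
  is_lim_seq u 0 -> is_lim_seq (fun n => c * u n) 0.
Proof.
  intros Hu; replace (Finite 0) with (Rbar_mult c 0) by (simpl; now rewrite Rmult_0_r).
  now apply is_lim_seq_scal_l.
Qed.

Lemma is_lim_seq_null_Rsum {T} (u : T -> nat -> R) l :
  (forall x, In x l -> is_lim_seq (u x) 0) -> is_lim_seq (fun n => \sum_(x <- l) u x n) 0.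
Proof.
  intros H; rewrite <- (Rsum_eq_0 (fun _ => 0) l) by reflexivity; now apply is_lim_seq_Rsum.
Qed.

Lemma is_lim_seq_null_le (u e : nat -> R) :
  eventually (fun n => Rabs (u n) <= e n) -> is_lim_seq e 0 -> is_lim_seq u 0.
Proof.
  intros H He; apply is_lim_seq_abs_0.
  apply (is_lim_seq_le_le_loc (fun _ => 0) _ e); [|apply is_lim_seq_const|assumption].
  revert H; apply filter_imp; intros n H; split; [apply Rabs_pos|assumption].
Qed.

Lemma one_le_INR_S n : 1 <= INR (S n).
Proof. apply (le_INR 1); lia. Qed.

Lemma is_lim_seq_inv_INR : is_lim_seq (fun n => / INR n) 0.
Proof. exact (is_lim_seq_inv _ _ is_lim_seq_INR ltac:(discriminate)). Qed.

Lemma is_lim_seq_inv_sqrt_INR : is_lim_seq (fun n => / sqrt (INR n)) 0.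
Proof.
  rewrite <- sqrt_0; apply is_lim_seq_ext with (fun n => sqrt (/ INR n)).
  - intros n; apply sqrt_inv.
  - apply is_lim_seq_continuous; [apply continuity_pt_sqrt; lra|apply is_lim_seq_inv_INR].
Qed.

Lemma is_lim_seq_inv_sqrt_INR_S : is_lim_seq (fun n => / sqrt (INR (S n))) 0.
Proof. apply (is_lim_seq_incr_1 (fun n => / sqrt (INR n))), is_lim_seq_inv_sqrt_INR. Qed.

Lemma is_lim_seq_INR_S_exp_half : is_lim_seq (fun n => INR (S n) * exp (- INR n / 2)) 0.
Proof.
  apply is_lim_seq_null_le with (fun n => 16 * / INR (S n)).
  - exists 0%nat; intros n _.
    assert (Hn := pos_INR n). assert (Hexp := exp_ineq1_le (INR n / 4)).
    rewrite Rabs_pos_eq by (apply Rmult_le_pos; [apply pos_INR|apply Rlt_le, exp_pos]).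
    replace (- INR n / 2) with (- (INR n / 4 + INR n / 4)) by field.
    rewrite exp_Ropp, exp_plus, S_INR.
    set (e := exp (INR n / 4)) in *.
    apply Rmult_le_reg_r with (e * e * (INR n + 1)); [nra|].
    replace ((INR n + 1) * / (e * e) * (e * e * (INR n + 1))) with ((INR n + 1) * (INR n + 1))
      by (field; nra).
    replace (16 * / (INR n + 1) * (e * e * (INR n + 1))) with (16 * (e * e)) by (field; lra).
    nra.
  - apply is_lim_seq_null_scal, (is_lim_seq_incr_1 (fun n => / INR n)), is_lim_seq_inv_INR.
Qed.

Definition unif_null {X} (P : X -> Prop) (D : nat -> X -> R) : Prop :=
  exists e, is_lim_seq e 0 /\ eventually (fun N => forall x, P x -> Rabs (D N x) <= e N).

Lemma unif_null_ext {X} (P : X -> Prop) D E :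
  (forall N x, P x -> D N x = E N x) -> unif_null P D -> unif_null P E.
Proof.
  intros H [e [He HD]]; exists e; split; [assumption|].
  revert HD; apply filter_imp; intros N HD x Hx; rewrite <- H; auto.
Qed.

Lemma unif_null_0 {X} (P : X -> Prop) : unif_null P (fun _ _ => 0).
Proof.
  exists (fun _ => 0); split; [apply is_lim_seq_const|].
  exists 0%nat; intros; rewrite Rabs_R0; apply Rle_refl.
Qed.

Lemma unif_null_plus {X} (P : X -> Prop) D E :
  unif_null P D -> unif_null P E -> unif_null P (fun N x => D N x + E N x).
Proof.
  intros [d [Hd HD]] [e [He HE]]; exists (fun N => d N + e N); split.
  - now apply is_lim_seq_null_plus.
  - generalize (filter_and _ _ HD HE); apply filter_imp; intros N [HD' HE'] x Hx.
    eapply Rle_trans; [apply Rabs_triang|]; apply Rplus_le_compat; auto.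
Qed.

Lemma unif_null_scal {X} (P : X -> Prop) (c : R) D :
  unif_null P D -> unif_null P (fun N x => c * D N x).
Proof.
  intros [d [Hd HD]]; exists (fun N => Rabs c * d N); split.
  - now apply is_lim_seq_null_scal.
  - revert HD; apply filter_imp; intros N HD x Hx; rewrite Rabs_mult.
    apply Rmult_le_compat_l; [apply Rabs_pos|auto].
Qed.

Lemma unif_null_Rsum {T X} (P : X -> Prop) (D : T -> nat -> X -> R) l :
  (forall a, In a l -> unif_null P (D a)) -> unif_null P (fun N x => \sum_(a <- l) D a N x).
Proof.
  induction l as [|a l IH]; intros H; [apply unif_null_0|].
  apply (unif_null_plus P (D a)); [apply H; now left|].
  apply IH; intros; apply H; now right.
Qed.

Lemma unif_null_comp {X Y} (P : X -> Prop) (Q : Y -> Prop) (g : Y -> X) D :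
  (forall x, Q x -> P (g x)) -> unif_null P D -> unif_null Q (fun N x => D N (g x)).
Proof.
  intros Hg [e [He HD]]; exists e; split; [assumption|].
  revert HD; apply filter_imp; intros N HD x Hx; auto.
Qed.

Lemma unif_null_of_is_derive (c : R) (D D' : nat -> R -> R) :
  (forall N x, is_derive (D N) x (D' N x)) -> is_lim_seq (fun N => D N 0) 0 ->
  unif_null (fun x => 0 <= x <= c) D' -> unif_null (fun x => 0 <= x <= c) D.
Proof.
  intros Hder Hat0 [e [He HD']]. exists (fun N => Rabs (D N 0) + c * e N); split.
  - apply is_lim_seq_null_plus; [now apply (is_lim_seq_abs_0 (fun N => D N 0))|].
    now apply is_lim_seq_null_scal.
  - revert HD'; apply filter_imp; intros N HD' x Hx.
    assert (Hvar : Rabs (D N x - D N 0) <= e N * Rabs (x - 0)).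
    { apply Rabs_diff_le_of_is_derive with (D' N); [intros; apply Hder|].
      intros y; rewrite Rmin_left, Rmax_right by lra; intros Hy; apply HD'; lra. }
    rewrite Rminus_0_r, (Rabs_pos_eq x) in Hvar by lra.
    assert (0 <= e N) by (eapply Rle_trans; [apply Rabs_pos|apply (HD' x Hx)]).
    replace (D N x) with (D N 0 + (D N x - D N 0)) by ring.
    eapply Rle_trans; [apply Rabs_triang|]. nra.
Qed.

(** * Divided powers and exponential polynomials *)

Definition divpow (a : nat) (x : R) : R := x ^ a / INR (fact a).

Lemma divpow_0 x : divpow 0 x = 1.
Proof. unfold divpow; simpl; field. Qed.

Lemma divpow_1 x : divpow 1 x = x.
Proof. unfold divpow; simpl; field. Qed.

Lemma divpow_S_at_0 a : divpow (S a) 0 = 0.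
Proof. unfold divpow; rewrite pow_ne_zero by lia; unfold Rdiv; ring. Qed.

Lemma divpow_nonneg a x : 0 <= x -> 0 <= divpow a x.
Proof. intros H; apply Rle_mult_inv_pos; [now apply pow_le|apply INR_fact_lt_0]. Qed.

Lemma divpow_incr a x y : 0 <= x <= y -> divpow a x <= divpow a y.
Proof.
  intros H; apply Rmult_le_compat_r; [|now apply pow_incr].
  apply Rlt_le, Rinv_0_lt_compat, INR_fact_lt_0.
Qed.

Lemma is_derive_divpow_S a x : is_derive (divpow (S a)) x (divpow a x).
Proof.
  assert (Ha := INR_fact_neq_0 a). assert (HSa : INR (S a) <> 0) by (apply not_0_INR; lia).
  apply is_derive_ext with (fun y => / INR (fact (S a)) * y ^ S a).
  { intros y; unfold divpow; apply Rmult_comm. }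
  evar_last; [apply is_derive_scal, (is_derive_pow (fun y => y)), (is_derive_id (K := R_AbsRing))|].
  change (@one R_AbsRing) with 1; unfold divpow; rewrite fact_simpl, mult_INR; simpl Nat.pred.
  field; auto.
Qed.

Lemma continuous_divpow {U : UniformSpace} a (f : U -> R) x :
  continuous f x -> continuous (fun y => divpow a (f y)) x.
Proof.
  destruct a as [|a].
  - intros _; apply continuous_ext with (fun _ => 1); [|apply continuous_const].
    intros y; now rewrite divpow_0.
  - apply continuous_comp_is_derive with (divpow a (f x)), is_derive_divpow_S.
Qed.

Lemma divpow_le_exp a x : 0 <= x -> divpow a x <= exp x.
Proof.
  intros Hx; apply Rle_trans with (sum_f_R0 (fun k => divpow k x) a); [|now apply exp_ge_taylor].
  destruct a as [|a]; [apply Rle_refl|].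
  rewrite tech5; enough (0 <= sum_f_R0 (fun k => divpow k x) a) by lra.
  apply cond_pos_sum; intros k; now apply divpow_nonneg.
Qed.

Lemma divpow_le_exp_half a x : 0 <= x -> divpow a x <= 2 ^ a * exp (x / 2).
Proof.
  intros Hx. replace (divpow a x) with (2 ^ a * divpow a (x / 2)).
  - apply Rmult_le_compat_l; [apply pow_le; lra|apply divpow_le_exp; lra].
  - unfold divpow, Rdiv. rewrite Rpow_mult_distr, pow_inv. field.
    split; [apply INR_fact_neq_0|apply pow_nonzero; lra].
Qed.

(* The coefficient of [y ^ A] in the product of [sum_A c A * y ^ A] and [exp (y * w)]. *)
Definition exp_conv (c : nat -> R) (A : nat) (w : R) : R :=
  \sum_(a < S A) c (A - a)%nat * divpow a w.

Lemma exp_conv_at_0 c A : exp_conv c A 0 = c A.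
Proof.
  unfold exp_conv; rewrite Rsum_S_first, Nat.sub_0_r, divpow_0, Rsum_eq_0; [ring|].
  intros a _; rewrite divpow_S_at_0; ring.
Qed.

Lemma exp_conv_delta c A w : c 0%nat = 1 -> (forall a, c (S a) = 0) -> exp_conv c A w = divpow A w.
Proof.
  intros Hc0 HcS; unfold exp_conv; rewrite Rsum_S, Nat.sub_diag, Hc0, Rsum_eq_0; [ring|].
  intros a Ha; apply in_seq in Ha.
  replace (A - a)%nat with (S (A - S a)) by lia; rewrite HcS; ring.
Qed.

Lemma exp_conv_nonneg c A w : (forall a, 0 <= c a) -> 0 <= w -> 0 <= exp_conv c A w.
Proof.
  intros Hc Hw; apply Rsum_nonneg; intros a _.
  apply Rmult_le_pos; [apply Hc|now apply divpow_nonneg].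
Qed.

Lemma is_derive_exp_conv_0 c w : is_derive (exp_conv c 0) w 0.
Proof.
  apply is_derive_ext with (fun _ => c 0%nat); [|apply (is_derive_const (c 0%nat))].
  intros y; unfold exp_conv; rewrite Rsum_S, divpow_0; simpl; ring.
Qed.

Lemma is_derive_exp_conv_S c A w : is_derive (exp_conv c (S A)) w (exp_conv c A w).
Proof.
  apply is_derive_ext with (fun y => c (S A) + \sum_(a < S A) c (A - a)%nat * divpow (S a) y).
  { intros y; unfold exp_conv; rewrite (Rsum_S_first _ (S A)), divpow_0, Rmult_1_r; reflexivity. }
  rewrite <- (Rplus_0_l (exp_conv c A w)).
  apply (is_derive_plus (fun _ => c (S A))); [apply (is_derive_const (c (S A)))|].
  apply is_derive_Rsum; intros a; apply is_derive_scal, is_derive_divpow_S.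
Qed.

Lemma continuous_exp_conv {U : UniformSpace} c A (f : U -> R) x :
  continuous f x -> continuous (fun y => exp_conv c A (f y)) x.
Proof.
  intros Hf; apply continuous_comp_is_derive
    with (match A with O => 0 | S A' => exp_conv c A' (f x) end); [|assumption].
  destruct A; [apply is_derive_exp_conv_0|apply is_derive_exp_conv_S].
Qed.

Section ExpConvRecurrence.

(* In terms of generating functions: [(d - y) * c(y) = s(y)]. *)
Variables (d : R) (c s : nat -> R).
Hypothesis c_0 : d * c 0%nat = s 0%nat.
Hypothesis c_S : forall A, d * c (S A) = c A + s (S A).

Lemma is_derive_exp_conv_rec A w :
  is_derive (exp_conv c A) w (d * exp_conv c A w - exp_conv s A w).
Proof.
  destruct A as [|A].
  - replace (d * exp_conv c 0 w - exp_conv s 0 w) with 0; [apply is_derive_exp_conv_0|].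
    unfold exp_conv; rewrite !Rsum_S; simpl; rewrite <- c_0; ring.
  - replace (d * exp_conv c (S A) w - exp_conv s (S A) w) with (exp_conv c A w);
      [apply is_derive_exp_conv_S|].
    unfold exp_conv at 2 3; rewrite <- Rsum_scal, <- Rsum_minus, Rsum_S, Nat.sub_diag, <- c_0.
    rewrite (Rsum_ext_lt _ (fun a => c (A - a)%nat * divpow a w)); [unfold exp_conv; ring|].
    intros a Ha; replace (S A - a)%nat with (S (A - a)) by lia.
    rewrite <- Rmult_assoc, c_S; ring.
Qed.

Lemma is_derive_exp_mult_exp_conv A w :
  is_derive (fun w => exp (- d * w) * exp_conv c A w) w (- (exp (- d * w) * exp_conv s A w)).
Proof.
  evar_last; [apply is_derive_Rmult; [|apply is_derive_exp_conv_rec]|].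
  - instantiate (1 := - d * exp (- d * w)); auto_derive; [trivial|ring].
  - simpl; ring.
Qed.

End ExpConvRecurrence.

(** * Hyperbolic functions and the Gudermannian *)

Lemma exp_le x y : x <= y -> exp x <= exp y.
Proof. intros [H| ->]; [now apply Rlt_le, exp_increasing|apply Rle_refl]. Qed.

Lemma is_derive_sinh w : is_derive sinh w (cosh w).
Proof. apply is_derive_Reals, derivable_pt_lim_sinh. Qed.

Lemma is_derive_cosh w : is_derive cosh w (sinh w).
Proof. apply is_derive_Reals, derivable_pt_lim_cosh. Qed.

Lemma cosh_sqr w : cosh w * cosh w = 1 + sinh w * sinh w.
Proof.
  assert (Hexp : exp w * exp (- w) = 1) by (rewrite <- exp_plus, Rplus_opp_r; apply exp_0).
  unfold cosh, sinh; nra.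
Qed.

Lemma cosh_pos w : 0 < cosh w.
Proof. unfold cosh; assert (Hexp := exp_pos w); assert (Hexp' := exp_pos (- w)); lra. Qed.

Lemma cosh_ge_1 w : 1 <= cosh w.
Proof. assert (Hsqr := cosh_sqr w); assert (Hpos := cosh_pos w); nra. Qed.

Lemma inv_cosh_pos w : 0 < / cosh w.
Proof. apply Rinv_0_lt_compat, cosh_pos. Qed.

Lemma inv_cosh_le_1 w : / cosh w <= 1.
Proof. rewrite <- Rinv_1; apply Rinv_le_contravar; [lra|apply cosh_ge_1]. Qed.

Lemma inv_cosh_le_exp w : / cosh w <= 2 * exp (- w).
Proof.
  replace (2 * exp (- w)) with (/ (exp w / 2)).
  - assert (Hexp := exp_pos w); assert (Hexp' := exp_pos (- w)).
    apply Rinv_le_contravar; unfold cosh; lra.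
  - rewrite exp_Ropp; field. assert (Hexp := exp_pos w); lra.
Qed.

Lemma sinh_bounds w : 0 <= w -> 0 <= sinh w <= cosh w.
Proof.
  intros Hw; assert (Hle := exp_le (- w) w ltac:(lra)); assert (Hexp := exp_pos (- w)).
  unfold sinh, cosh; lra.
Qed.

Lemma continuous_sinh {U : UniformSpace} (f : U -> R) x :
  continuous f x -> continuous (fun y => sinh (f y)) x.
Proof. apply continuous_comp_is_derive with (cosh (f x)), is_derive_sinh. Qed.

Lemma continuous_cosh {U : UniformSpace} (f : U -> R) x :
  continuous f x -> continuous (fun y => cosh (f y)) x.
Proof. apply continuous_comp_is_derive with (sinh (f x)), is_derive_cosh. Qed.

Definition gd (w : R) : R := atan (sinh w).

Lemma gd_0 : gd 0 = 0.
Proof. unfold gd; rewrite sinh_0; apply atan_0. Qed.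

Lemma gd_bounds w : 0 <= w -> 0 <= gd w <= PI / 2.
Proof.
  intros Hw; assert (Hatan := atan_bound (sinh w)); unfold gd; split; [|lra].
  rewrite <- atan_0; destruct (sinh_bounds w Hw) as [[Hs| <-] _];
    [now apply Rlt_le, atan_increasing|apply Rle_refl].
Qed.

Lemma is_derive_gd w : is_derive gd w (/ cosh w).
Proof.
  evar_last; [apply (is_derive_comp atan sinh w _ _ (is_derive_atan _) (is_derive_sinh w))|].
  unfold scal; simpl; unfold mult; simpl; unfold Rsqr; rewrite <- cosh_sqr.
  field; assert (Hcosh := cosh_pos w); lra.
Qed.

Lemma sqrt_1_plus_sinh_sqr w : sqrt (1 + (sinh w)²) = cosh w.
Proof.
  unfold Rsqr; rewrite <- cosh_sqr; apply sqrt_square, Rlt_le, cosh_pos.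
Qed.

Lemma cos_gd w : cos (gd w) = / cosh w.
Proof. unfold gd; rewrite cos_atan, sqrt_1_plus_sinh_sqr; apply Rmult_1_l. Qed.

Lemma sin_gd w : sin (gd w) = sinh w / cosh w.
Proof. unfold gd; rewrite sin_atan, sqrt_1_plus_sinh_sqr; reflexivity. Qed.

Lemma continuous_gd {U : UniformSpace} (f : U -> R) x :
  continuous f x -> continuous (fun y => gd (f y)) x.
Proof. apply continuous_comp_is_derive with (/ cosh (f x)), is_derive_gd. Qed.

#[local] Hint Resolve continuous_divpow continuous_exp_conv continuous_sinh continuous_cosh
  continuous_gd cosh_pos : continuity.

(** * Alternating series and sequences of slow growth *)

Lemma Rsum_sum_f_R0 (f : nat -> R) n : \sum_(i < S n) f i = sum_f_R0 f n.
Proof.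
  induction n as [|n IH]; [unfold Rsum_list; simpl; ring|]. now rewrite Rsum_S, IH.
Qed.

Lemma ex_finite_lim_alternating (f : nat -> R) :
  is_lim_seq f 0 -> (forall i, f (S i) <= f i) ->
  ex_finite_lim_seq (fun N => \sum_(i < N) (-1) ^ i * f i).
Proof.
  intros Hf Hdecr. destruct (alternated_series f Hdecr) as [l Hl].
  - now apply is_lim_seq_Reals.
  - exists l; apply is_lim_seq_incr_1; apply is_lim_seq_Reals in Hl.
    eapply is_lim_seq_ext; [|exact Hl]. intros N; now rewrite <- Rsum_sum_f_R0.
Qed.

(* [f + g] and [g] are both decreasing. *)
Lemma ex_finite_lim_alternating_of_increments (f g : nat -> R) :
  is_lim_seq f 0 -> is_lim_seq g 0 -> (forall i, g (S i) <= g i) ->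
  (forall i, f (S i) - f i <= g i - g (S i)) ->
  ex_finite_lim_seq (fun N => \sum_(i < N) (-1) ^ i * f i).
Proof.
  intros Hf Hg Hdecr Hincr.
  destruct (ex_finite_lim_alternating (fun i => f i + g i)) as [l1 Hsum].
  - now apply is_lim_seq_null_plus.
  - intros i; specialize (Hincr i); lra.
  - destruct (ex_finite_lim_alternating g Hg Hdecr) as [l2 Hlim]; exists (l1 - l2).
    eapply is_lim_seq_ext; [|exact (is_lim_seq_minus' _ _ _ _ Hsum Hlim)].
    intros N; cbv beta; rewrite <- Rsum_minus; apply Rsum_ext; intros; ring.
Qed.

Lemma sqrt_INR_S_increment n : 1 <= 2 * (sqrt (INR (S n)) * (sqrt (INR (S n)) - sqrt (INR n))).
Proof.
  assert (Hn := pos_INR n). rewrite S_INR.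
  assert (Hx := sqrt_sqrt (INR n) Hn). assert (Hy := sqrt_sqrt (INR n + 1) ltac:(lra)).
  assert (Hx0 := sqrt_pos (INR n)). assert (Hy0 := sqrt_pos (INR n + 1)).
  assert (sqrt (INR n) <= sqrt (INR n + 1)) by (apply sqrt_le_1_alt; lra). nra.
Qed.

Lemma sqrt_INR_S_pos n : 0 < sqrt (INR (S n)).
Proof. apply sqrt_lt_R0, lt_0_INR; lia. Qed.

Lemma sqrt_INR_S_div n : sqrt (INR (S n)) / INR (S n) = / sqrt (INR (S n)).
Proof.
  assert (Hs := sqrt_INR_S_pos n); assert (Hn := one_le_INR_S n).
  rewrite <- (sqrt_sqrt (INR (S n))) at 2 by lra; field; lra.
Qed.

(* The denominator [2 n_r - r] attached to the index [n_r = n] at depth [r]. *)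
Definition den (r n : nat) : R := 2 * INR n - INR r.

Lemma INR_le_den r i : (r <= i)%nat -> INR (S i) <= den (S r) (S i).
Proof. intros H; apply le_INR in H; unfold den; rewrite !S_INR; lra. Qed.

Lemma den_pos r i : (r <= i)%nat -> 0 < den (S r) (S i).
Proof. intros Hr; assert (Hn := one_le_INR_S i); apply INR_le_den in Hr; lra. Qed.

(* The terms of a [Tbar] series need not decrease; this bounds their increments. *)
Definition slow_growth (r : nat) (x : nat -> R) : Prop :=
  (forall i, (i < r)%nat -> x i = 0) /\ 0 <= x 0%nat /\
  exists C, 0 <= C /\ forall i, 0 <= x (S i) - x i <= C * / sqrt (INR (S i)).

Lemma slow_growth_nonneg r x : slow_growth r x -> forall i, 0 <= x i.
Proof.
  intros [_ [Hx0 [C [_ HC]]]] i; induction i as [|i IH]; [assumption|].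
  specialize (HC i); lra.
Qed.

Lemma slow_growth_le_sqrt r x : slow_growth r x ->
  exists C, 0 <= C /\ forall i, x i <= C * sqrt (INR (S i)).
Proof.
  intros [_ [Hx0 [C [HC0 HC]]]]; exists (x 0%nat + 2 * C); split; [lra|intros i].
  assert (Hsum : x i - x 0%nat <= 2 * C * sqrt (INR i)).
  { apply Rle_trans with (\sum_(j < i) 2 * C * (sqrt (INR (S j)) - sqrt (INR j))).
    - rewrite <- Rsum_telescope; apply Rsum_le; intros j _.
      eapply Rle_trans; [apply HC|].
      assert (Hj := sqrt_INR_S_increment j). assert (Hj0 := sqrt_INR_S_pos j).
      rewrite (Rmult_comm 2), Rmult_assoc; apply Rmult_le_compat_l; [assumption|].
      apply Rmult_le_reg_l with (sqrt (INR (S j))); [assumption|]. rewrite Rinv_r by lra; lra.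
    - rewrite Rsum_scal, (Rsum_telescope (fun j => sqrt (INR j))).
      simpl (INR 0); rewrite sqrt_0; lra. }
  assert (Hsqrt : 1 <= sqrt (INR (S i)))
    by (rewrite <- sqrt_1; apply sqrt_le_1_alt, one_le_INR_S).
  assert (Hi : sqrt (INR i) <= sqrt (INR (S i))) by (apply sqrt_le_1_alt; rewrite S_INR; lra).
  nra.
Qed.

Lemma slow_growth_0 r : slow_growth r (fun _ => 0).
Proof. repeat split; [lra|]. exists 0; split; intros; lra. Qed.

Lemma slow_growth_plus r x y :
  slow_growth r x -> slow_growth r y -> slow_growth r (fun i => x i + y i).
Proof.
  intros [Hx [Hx0 [C [HC0 HC]]]] [Hy [Hy0 [D [HD0 HD]]]]; repeat split.
  - intros i Hi; rewrite Hx, Hy by assumption; ring.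
  - lra.
  - exists (C + D); split; [lra|intros i]; specialize (HC i); specialize (HD i); lra.
Qed.

Lemma slow_growth_scal r c x : 0 <= c -> slow_growth r x -> slow_growth r (fun i => c * x i).
Proof.
  intros Hc [Hx [Hx0 [C [HC0 HC]]]]; repeat split.
  - intros i Hi; rewrite Hx by assumption; ring.
  - nra.
  - exists (c * C); split; [nra|intros i]; specialize (HC i).
    rewrite <- Rmult_minus_distr_l, Rmult_assoc.
    split; [apply Rmult_le_pos; lra|apply Rmult_le_compat_l; lra].
Qed.

Lemma slow_growth_Rsum {T} r (x : T -> nat -> R) l :
  (forall a, In a l -> slow_growth r (x a)) -> slow_growth r (fun i => \sum_(a <- l) x a i).
Proof.
  induction l as [|a l IH]; intros H; [apply slow_growth_0|].
  apply (slow_growth_plus r (x a)); [apply H; now left|].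
  apply IH; intros; apply H; now right.
Qed.

Lemma inv_den_pow_le r k i : (r <= i)%nat -> (1 <= k)%nat ->
  0 < / den (S r) (S i) ^ k <= / INR (S i).
Proof.
  intros Hi Hk; assert (Hd := INR_le_den r i Hi); assert (Hn := one_le_INR_S i).
  split; [apply Rinv_0_lt_compat, pow_lt; lra|apply Rinv_le_contravar; [lra|]].
  apply Rle_trans with (den (S r) (S i) ^ 1); [lra|apply Rle_pow; [lra|assumption]].
Qed.

Lemma slow_growth_term_le r x k : slow_growth r x -> (1 <= k)%nat ->
  exists C, 0 <= C /\ forall i, 0 <= x i / den (S r) (S i) ^ k <= C * / sqrt (INR (S i)).
Proof.
  intros Hx Hk; destruct (slow_growth_le_sqrt r x Hx) as [C [HC0 HC]].
  exists C; split; [assumption|intros i].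
  assert (Hxi := slow_growth_nonneg r x Hx i); assert (Hs := Rinv_0_lt_compat _ (sqrt_INR_S_pos i)).
  destruct (le_lt_dec r i) as [Hi|Hi].
  - destruct (inv_den_pow_le r k i Hi Hk) as [Hd Hle].
    split; [apply Rmult_le_pos; lra|].
    rewrite <- sqrt_INR_S_div; unfold Rdiv; rewrite <- Rmult_assoc.
    apply Rmult_le_compat; [assumption|lra|apply HC|assumption].
  - destruct Hx as [Hx _]; rewrite Hx by assumption; unfold Rdiv; nra.
Qed.

Lemma slow_growth_chain r x k : slow_growth r x -> (1 <= k)%nat ->
  slow_growth (S r) (fun N => \sum_(i < N) x i / den (S r) (S i) ^ k).
Proof.
  intros Hx Hk; repeat split.
  - intros N HN; apply Rsum_eq_0; intros i Hi; apply in_seq in Hi.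
    destruct Hx as [Hx _]; rewrite Hx by lia; unfold Rdiv; ring.
  - apply Rle_refl.
  - destruct (slow_growth_term_le r x k Hx Hk) as [C [HC0 HC]].
    exists C; split; [assumption|intros i]. rewrite Rsum_S, Rplus_minus_l; apply HC.
Qed.

Lemma inv_sqrt_INR_S_increment n :
  / sqrt (INR (S n)) * / INR (S (S n)) <= 2 * (/ sqrt (INR (S n)) - / sqrt (INR (S (S n)))).
Proof.
  assert (Hincr := sqrt_INR_S_increment (S n)).
  assert (Hx := sqrt_INR_S_pos n); assert (Hy := sqrt_INR_S_pos (S n)).
  assert (Hyy := sqrt_sqrt (INR (S (S n))) (pos_INR _)).
  revert Hincr Hx Hy Hyy; generalize (sqrt (INR (S n))) (sqrt (INR (S (S n)))).
  intros x y Hincr Hx Hy <-.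
  apply Rmult_le_reg_r with (x * (y * y)); [nra|].
  replace (/ x * / (y * y) * (x * (y * y))) with 1 by (field; lra).
  replace (2 * (/ x - / y) * (x * (y * y))) with (2 * (y * (y - x))) by (field; lra). exact Hincr.
Qed.

Lemma slow_growth_term_increment r x k : slow_growth r x -> (1 <= k)%nat ->
  exists C, 0 <= C /\ forall i, x (S i) / den (S r) (S (S i)) ^ k - x i / den (S r) (S i) ^ k <=
    C * (/ sqrt (INR (S i)) - / sqrt (INR (S (S i)))).
Proof.
  intros Hx Hk; assert (Hpos := slow_growth_nonneg r x Hx).
  destruct Hx as [Hx0 [_ [C [HC0 HC]]]].
  exists (C * 2); split; [lra|intros i]. rewrite Rmult_assoc.
  apply Rle_trans with (C * (/ sqrt (INR (S i)) * / INR (S (S i))));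
    [|apply Rmult_le_compat_l; [assumption|apply inv_sqrt_INR_S_increment]].
  rewrite <- Rmult_assoc; destruct (HC i) as [Hincr HCi].
  assert (Hn : 0 < / INR (S (S i))) by (apply Rinv_0_lt_compat, lt_0_INR; lia).
  destruct (le_lt_dec r (S i)) as [Hi|Hi]; [|rewrite !Hx0 by lia; unfold Rdiv; nra].
  destruct (inv_den_pow_le r k (S i) Hi Hk) as [Hd Hle].
  apply Rle_trans with ((x (S i) - x i) * / den (S r) (S (S i)) ^ k);
    [|apply Rmult_le_compat; lra].
  enough (x i * / den (S r) (S (S i)) ^ k <= x i * / den (S r) (S i) ^ k) by (unfold Rdiv; lra).
  destruct (le_lt_dec r i) as [Hi'|Hi']; [|rewrite Hx0 by assumption; lra].
  assert (Hd' := den_pos r i Hi').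
  apply Rmult_le_compat_l; [apply Hpos|]. apply Rinv_le_contravar; [now apply pow_lt|].
  apply pow_incr; split; [lra|]. unfold den; rewrite (S_INR (S i)); lra.
Qed.

Lemma ex_finite_lim_alternating_slow_growth r x k : slow_growth r x -> (1 <= k)%nat ->
  ex_finite_lim_seq (fun N => \sum_(i < N) (-1) ^ i * (x i / den (S r) (S i) ^ k)).
Proof.
  intros Hx Hk.
  destruct (slow_growth_term_le r x k Hx Hk) as [B [_ HB]].
  destruct (slow_growth_term_increment r x k Hx Hk) as [C [HC0 HC]].
  apply ex_finite_lim_alternating_of_increments with (g := fun i => C * / sqrt (INR (S i))).
  - apply is_lim_seq_null_le with (fun i => B * / sqrt (INR (S i)));
      [|apply is_lim_seq_null_scal, is_lim_seq_inv_sqrt_INR_S].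
    exists 0%nat; intros i _; rewrite Rabs_pos_eq; apply HB.
  - apply is_lim_seq_null_scal, is_lim_seq_inv_sqrt_INR_S.
  - intros i; apply Rmult_le_compat_l; [assumption|].
    apply Rinv_le_contravar; [apply sqrt_INR_S_pos|]. apply sqrt_le_1_alt, le_INR; lia.
  - intros i; rewrite <- Rmult_minus_distr_l; apply HC.
Qed.

(** * Sums over increasing sequences and compositions *)

Lemma Rsum_incr_lists_snoc len lo hi (F : list nat -> R) : (lo <= S hi)%nat ->
  \sum_(ns <- incr_lists (S len) lo (S hi)) F ns =
  \sum_(ns <- incr_lists (S len) lo hi) F ns +
  \sum_(ns <- incr_lists len lo hi) F (ns ++ [S hi]).
Proof.
  revert lo F; induction len as [|len IH]; intros lo F Hlo;
    [|remember (S len) as len' eqn:Elen];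
    cbn [incr_lists]; rewrite !Rsum_flat_map;
    replace (S (S hi) - lo)%nat with (S (S hi - lo)) by lia;
    rewrite seq_S, Rsum_app; replace (lo + (S hi - lo))%nat with (S hi) by lia.
  - unfold Rsum_list; simpl; ring.
  - assert (Hempty : incr_lists len' (S (S hi)) (S hi) = [])
      by (rewrite Elen; cbn [incr_lists]; now rewrite Nat.sub_diag).
    rewrite Rsum_cons, Rsum_nil, Hempty; change (\sum_(y <- map (cons (S hi)) []) F y) with 0.
    rewrite !Rplus_0_r, Elen at 1; cbn [incr_lists]; rewrite Rsum_flat_map, <- Rsum_plus.
    apply Rsum_ext; intros a Ha; apply in_seq in Ha.
    rewrite !map_map; apply (IH (S a) (fun ns => F (a :: ns))); lia.
Qed.

Lemma length_incr_lists len lo hi ns : In ns (incr_lists len lo hi) -> length ns = len.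
Proof.
  revert lo ns; induction len as [|len IH]; intros lo ns H; simpl in H.
  - destruct H as [<-|[]]; reflexivity.
  - apply in_flat_map in H as [a [_ H]]; apply in_map_iff in H as [ns' [<- H]].
    simpl; f_equal; eapply IH; eassumption.
Qed.

Lemma Tbar_prod_snoc i0 ks ns k n : length ks = length ns ->
  Tbar_prod i0 (ks ++ [k]) (ns ++ [n]) =
  Tbar_prod i0 ks ns / den (i0 + length ks) n ^ k.
Proof.
  revert i0 ns; induction ks as [|k' ks IH]; intros i0 [|n' ns] H; try discriminate.
  - unfold den; simpl; rewrite Nat.add_0_r; unfold Rdiv; ring.
  - injection H as H. cbn [Tbar_prod app length]. rewrite (IH (S i0) ns H), Nat.add_succ_comm.
    unfold Rdiv; ring.
Qed.

Lemma Rsum_Tbar_prod_snoc ks k (c : nat -> R) N :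
  \sum_(ns <- incr_lists (S (length ks)) 1 N) c (last ns 0%nat) * Tbar_prod 1 (ks ++ [k]) ns =
  \sum_(i < N) c (S i) * ((\sum_(ns <- incr_lists (length ks) 1 i) Tbar_prod 1 ks ns)
                           / den (S (length ks)) (S i) ^ k).
Proof.
  induction N as [|N IH]; [reflexivity|].
  rewrite Rsum_incr_lists_snoc, IH, Rsum_S by lia; f_equal.
  unfold Rdiv; rewrite (Rmult_comm (Rsum_list _)), <- Rmult_assoc, <- Rsum_scal.
  apply Rsum_ext; intros ns Hns; apply length_incr_lists in Hns.
  rewrite last_last, Tbar_prod_snoc by easy; unfold Rdiv; simpl (1 + _)%nat; ring.
Qed.

(* [rks] lists the exponents in reverse order, so that the recursion is on the outermost index. *)
Fixpoint chain_sum (rks : list nat) (N : nat) : R :=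
  match rks with
  | [] => 1
  | k :: t => \sum_(i < N) chain_sum t i / den (S (length t)) (S i) ^ k
  end.

Lemma Rsum_Tbar_prod ks N :
  \sum_(ns <- incr_lists (length ks) 1 N) Tbar_prod 1 ks ns = chain_sum (rev ks) N.
Proof.
  revert N; induction ks as [|k ks IH] using rev_ind; intros N.
  - unfold Rsum_list; simpl; ring.
  - rewrite length_app, Nat.add_1_r, rev_app_distr; cbn [chain_sum rev app]; rewrite length_rev.
    rewrite (Rsum_ext _ (fun ns => 1 * Tbar_prod 1 (ks ++ [k]) ns)) by (intros; ring).
    rewrite (Rsum_Tbar_prod_snoc ks k (fun _ => 1)).
    apply Rsum_ext; intros i _; rewrite IH; ring.
Qed.

Lemma Tbar_partial_snoc ks k N :
  Tbar_partial (ks ++ [k]) N =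
  \sum_(i < N) (-1) ^ S i * (2 ^ S (length ks) *
    (chain_sum (rev ks) i / den (S (length ks)) (S i) ^ k)).
Proof.
  unfold Tbar_partial. rewrite length_app, Nat.add_1_r.
  rewrite (Rsum_Tbar_prod_snoc ks k (fun n => (-1) ^ n)), <- Rsum_scal.
  apply Rsum_ext; intros i _; rewrite Rsum_Tbar_prod; ring.
Qed.

Lemma slow_growth_chain_sum rks : (forall k, In k rks -> (1 <= k)%nat) ->
  slow_growth (length rks) (chain_sum rks).
Proof.
  induction rks as [|k t IH]; intros Hk.
  - repeat split; [simpl; lia|simpl; lra|]. exists 0; split; [lra|intros i; simpl; lra].
  - apply slow_growth_chain; [apply IH; intros; apply Hk; now right|apply Hk; now left].
Qed.

Lemma is_lim_seq_Tbar ks : (forall k, In k ks -> (1 <= k)%nat) -> ks <> [] ->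
  is_lim_seq (Tbar_partial ks) (Tbar ks).
Proof.
  intros Hks Hne.
  assert (Hcv : ex_finite_lim_seq (Tbar_partial ks)).
  { destruct ks as [|k ks _] using rev_ind; [easy|].
    assert (Hgrowth : slow_growth (length ks) (chain_sum (rev ks))).
    { rewrite <- length_rev; apply slow_growth_chain_sum.
      intros a Ha; apply Hks, in_or_app; left; now apply in_rev. }
    destruct (ex_finite_lim_alternating_slow_growth _ _ k Hgrowth) as [l Hl].
    { apply Hks, in_or_app; right; now left. }
    exists (- 2 ^ S (length ks) * l).
    eapply is_lim_seq_ext; [|exact (is_lim_seq_scal_l _ (- 2 ^ S (length ks)) _ Hl)].
    intros N; rewrite Tbar_partial_snoc, <- Rsum_scal; apply Rsum_ext; intros i _; simpl; ring. }
  destruct Hcv as [l Hl]; replace (Tbar ks) with l; [assumption|].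
  destruct ks; [easy|]. unfold Tbar; now rewrite (is_lim_seq_unique _ _ Hl).
Qed.

Lemma in_compositions r k ks : In ks (compositions r k) ->
  length ks = r /\ (r <= k)%nat /\ (forall a, In a ks -> (1 <= a)%nat).
Proof.
  revert k ks; induction r as [|r IH]; intros k ks H; cbn [compositions] in H.
  - destruct (Nat.eqb k 0); [|destruct H].
    destruct H as [<-|[]]; repeat split; [lia|intros a []].
  - apply in_flat_map in H as [a [Ha H]]; apply in_map_iff in H as [ks' [<- H]].
    apply in_seq in Ha; destruct (IH _ _ H) as [Hlen [Hle Hpos]].
    repeat split; [simpl; congruence|lia|].
    intros b [<-|Hb]; [lia|now apply Hpos].
Qed.

Lemma compositions_nil r k : (k < r)%nat -> compositions r k = [].
Proof.
  intros H; destruct (compositions r k) as [|ks l] eqn:E; [reflexivity|].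
  destruct (in_compositions r k ks) as [_ [Hle _]]; [rewrite E; now left|lia].
Qed.

Lemma Rsum_compositions_cons r k (F : list nat -> R) :
  \sum_(ks <- compositions (S r) k) F ks =
  \sum_(i < k) \sum_(ks <- compositions r (k - S i)) F (S i :: ks).
Proof.
  cbn [compositions]; rewrite Rsum_flat_map, Rsum_seq.
  apply Rsum_ext; intros i _; now rewrite map_map.
Qed.

Lemma Rsum_compositions_snoc r k (F : list nat -> R) :
  \sum_(ks <- compositions (S r) k) F ks =
  \sum_(i < k) \sum_(ks <- compositions r (k - S i)) F (ks ++ [S i]).
Proof.
  revert k F; induction r as [|r IH]; intros k F; rewrite Rsum_compositions_cons.
  - apply Rsum_ext; intros i _.
    cbn [compositions]; destruct (Nat.eqb (k - S i) 0); reflexivity.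
  - rewrite (Rsum_ext _ (fun i => \sum_(j < k - S i)
      \sum_(ks <- compositions r (k - S i - S j)) F (S i :: ks ++ [S j]))) by (intros; apply IH).
    rewrite Rsum_triangle; apply Rsum_ext; intros j _.
    rewrite Rsum_compositions_cons; apply Rsum_ext; intros i _.
    now replace (k - S i - S j)%nat with (k - S j - S i)%nat by lia.
Qed.

Definition comp_sum (B A N : nat) : R :=
  2 ^ B * \sum_(ks <- compositions B (A + B)) chain_sum (rev ks) N.

(* The contribution of [n_(B+1) = i + 1] to [comp_sum (S B) A]. *)
Definition comp_term (B A i : nat) : R :=
  \sum_(a < S A) 2 * comp_sum B (A - a) i / den (S B) (S i) ^ S a.

Lemma Rsum_compositions_comp_term B A N (c : nat -> R) (F : list nat -> R) :
  (forall ks k, length ks = B -> F (ks ++ [k]) = \sum_(i < N) c i * (2 ^ S B *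
     (chain_sum (rev ks) i / den (S B) (S i) ^ k))) ->
  \sum_(ks <- compositions (S B) (A + S B)) F ks = \sum_(i < N) c i * comp_term B A i.
Proof.
  intros HF; rewrite Rsum_compositions_snoc, (Rsum_extend _ (S A)); [|lia|].
  2:{ intros i Hi; rewrite compositions_nil by lia; reflexivity. }
  rewrite (Rsum_ext_lt _ (fun a => \sum_(i < N)
    c i * (2 * comp_sum B (A - a) i / den (S B) (S i) ^ S a))).
  { rewrite Rsum_exchange; apply Rsum_ext; intros i _; apply Rsum_scal. }
  intros a Ha; replace (A + S B - S a)%nat with (A - a + B)%nat by lia.
  rewrite (Rsum_ext _ (fun ks => \sum_(i < N)
    (c i * 2 / den (S B) (S i) ^ S a * 2 ^ B) * chain_sum (rev ks) i)).
  - rewrite Rsum_exchange; apply Rsum_ext; intros i _.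
    rewrite Rsum_scal; unfold comp_sum, Rdiv; ring.
  - intros ks Hks; apply in_compositions in Hks as [Hlen _]; rewrite HF by assumption.
    apply Rsum_ext; intros i _; rewrite <- (tech_pow_Rmult 2); unfold Rdiv; ring.
Qed.

Lemma comp_sum_0 A N : comp_sum 0 A N = if (A =? 0)%nat then 1 else 0.
Proof.
  unfold comp_sum; cbn [compositions]; rewrite Nat.add_0_r.
  destruct (Nat.eqb A 0); unfold Rsum_list; simpl; ring.
Qed.

Lemma comp_sum_S B A N : comp_sum (S B) A N = \sum_(i < N) comp_term B A i.
Proof.
  unfold comp_sum; rewrite <- Rsum_scal, (Rsum_compositions_comp_term B A N (fun _ => 1)).
  - apply Rsum_ext; intros; ring.
  - intros ks k Hks; rewrite rev_app_distr; cbn [chain_sum rev app]; rewrite length_rev, Hks.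
    rewrite <- Rsum_scal; apply Rsum_ext; intros; ring.
Qed.

Lemma is_lim_seq_W B A :
  is_lim_seq (fun N => \sum_(i < N) (-1) ^ S i * comp_term B A i) (W (A + S B) (S B)).
Proof.
  apply is_lim_seq_ext with
    (fun N => \sum_(ks <- compositions (S B) (A + S B)) Tbar_partial ks N).
  - intros N; apply Rsum_compositions_comp_term.
    intros ks k Hks; rewrite Tbar_partial_snoc, Hks; reflexivity.
  - unfold W; apply is_lim_seq_Rsum; intros ks Hks.
    apply in_compositions in Hks as [Hlen [_ Hpos]].
    apply is_lim_seq_Tbar; [assumption|now intros ->].
Qed.

Lemma slow_growth_comp_sum B A : slow_growth B (comp_sum B A).
Proof.
  apply slow_growth_scal; [apply pow_le; lra|].
  apply slow_growth_Rsum; intros ks Hks; apply in_compositions in Hks as [Hlen [_ Hpos]].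
  rewrite <- Hlen, <- length_rev; apply slow_growth_chain_sum.
  intros k Hk; apply Hpos; now apply in_rev.
Qed.

Lemma comp_sum_nonneg B A N : 0 <= comp_sum B A N.
Proof. exact (slow_growth_nonneg B _ (slow_growth_comp_sum B A) N). Qed.

Lemma comp_sum_eq_0 B A N : (N < B)%nat -> comp_sum B A N = 0.
Proof. apply (slow_growth_comp_sum B A). Qed.

Lemma comp_term_eq_0 B A i : (i < B)%nat -> comp_term B A i = 0.
Proof.
  intros Hi; apply Rsum_eq_0; intros a _; rewrite comp_sum_eq_0 by assumption.
  unfold Rdiv; ring.
Qed.

Lemma comp_term_nonneg B A i : 0 <= comp_term B A i.
Proof.
  destruct (le_lt_dec B i) as [Hi|Hi]; [|rewrite comp_term_eq_0 by assumption; apply Rle_refl].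
  apply Rsum_nonneg; intros a _; apply Rle_mult_inv_pos; [|now apply pow_lt, den_pos].
  assert (Hsum := comp_sum_nonneg B (A - a) i); lra.
Qed.

Lemma den_mult_comp_term_0 B i : den (S B) (S i) * comp_term B 0 i = 2 * comp_sum B 0 i.
Proof.
  destruct (le_lt_dec B i) as [Hi|Hi].
  - assert (Hd := den_pos B i Hi).
    unfold comp_term; rewrite Rsum_S; simpl; field; lra.
  - rewrite comp_term_eq_0, comp_sum_eq_0 by assumption; ring.
Qed.

Lemma den_mult_comp_term_S B A i :
  den (S B) (S i) * comp_term B (S A) i = comp_term B A i + 2 * comp_sum B (S A) i.
Proof.
  destruct (le_lt_dec B i) as [Hi|Hi].
  - assert (Hd := den_pos B i Hi).
    unfold comp_term; rewrite (Rsum_S_first _ (S A)), Rmult_plus_distr_l, <- Rsum_scal, Rplus_comm.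
    f_equal; [|rewrite pow_1, Nat.sub_0_r; field; lra].
    apply Rsum_ext; intros a _; rewrite Nat.sub_succ, <- (tech_pow_Rmult _ (S a)).
    field; split; [apply pow_nonzero|]; lra.
  - rewrite !comp_term_eq_0, comp_sum_eq_0 by assumption; ring.
Qed.

(** * The integral formula for [W] *)

Definition comp_poly (B A i : nat) : R -> R := exp_conv (fun A' => comp_sum B A' i) A.
Definition comp_term_poly (B A i : nat) : R -> R := exp_conv (fun A' => comp_term B A' i) A.

Lemma comp_poly_0 A i w : comp_poly 0 A i w = divpow A w.
Proof. apply exp_conv_delta; intros; apply comp_sum_0. Qed.

Lemma comp_poly_S_0 B A w : comp_poly (S B) A 0 w = 0.
Proof. apply Rsum_eq_0; intros a _; rewrite comp_sum_eq_0 by lia; ring. Qed.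

Lemma comp_poly_S_increment B A i w :
  comp_poly (S B) A (S i) w - comp_poly (S B) A i w = comp_term_poly B A i w.
Proof.
  unfold comp_poly, comp_term_poly, exp_conv; rewrite <- Rsum_minus; apply Rsum_ext; intros a _.
  rewrite !comp_sum_S, Rsum_S; ring.
Qed.

Lemma comp_poly_le B A : exists C, 0 <= C /\ forall i w, 0 <= w ->
  comp_poly B A i w <= C * (sqrt (INR (S i)) * exp (w / 2)).
Proof.
  destruct (Rsum_bounded (fun y : nat * R => 0 <= snd y)
    (fun a y => comp_sum B (A - a) (fst y) * divpow a (snd y))
    (fun y => sqrt (INR (S (fst y))) * exp (snd y / 2)) (seq 0 (S A))) as [C [HC0 HC]].
  - intros a _; destruct (slow_growth_le_sqrt B _ (slow_growth_comp_sum B (A - a))) as [C [HC0 HC]].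
    assert (Hpow : 0 < 2 ^ a) by (apply pow_lt; lra).
    exists (C * 2 ^ a); split; [nra|intros [i w] Hw]; simpl fst in *; simpl snd in *.
    replace (C * 2 ^ a * (sqrt (INR (S i)) * exp (w / 2)))
      with (C * sqrt (INR (S i)) * (2 ^ a * exp (w / 2))) by ring.
    apply Rmult_le_compat;
      [apply comp_sum_nonneg|now apply divpow_nonneg|apply HC|now apply divpow_le_exp_half].
  - exists C; split; [assumption|intros i w Hw]; exact (HC (i, w) Hw).
Qed.

Definition alt_exp (r n : nat) (w : R) : R := (-1) ^ n * exp (- den r n * w).

Lemma Rabs_alt_exp r n w : Rabs (alt_exp r n w) = exp (- den r n * w).
Proof.
  unfold alt_exp; rewrite Rabs_mult, pow_1_abs, Rmult_1_l.
  apply Rabs_pos_eq, Rlt_le, exp_pos.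
Qed.

Lemma cosh_mult_alt_exp r n w :
  2 * cosh w * alt_exp (S r) (S n) w = alt_exp r (S n) w - alt_exp r n w.
Proof.
  unfold alt_exp.
  replace (- den r n * w) with (w + - den (S r) (S n) * w) by (unfold den; rewrite !S_INR; ring).
  replace (- den r (S n) * w) with (- w + - den (S r) (S n) * w)
    by (unfold den; rewrite !S_INR; ring).
  rewrite !exp_plus; unfold cosh; simpl pow; field.
Qed.

(* Let [L_B,A(w)] be the alternating series of [W (A + B) B], truncated at [N], with
   [exp (- (2 n_B - B) w)] inserted.  For [B > 0], this is the sum over [a <= A] of
   [L_B,(A-a)(w) w^a / a!]: the combination whose derivative only involves depth [B - 1]. *)
Definition alt_chain (N B A : nat) (w : R) : R :=
  alt_exp B 0 w * comp_poly B A 0 w +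
  \sum_(i < N) alt_exp B (S i) w * (comp_poly B A (S i) w - comp_poly B A i w).

Definition alt_tail (N B A : nat) (w : R) : R := alt_exp B N w * comp_poly B A N w.

Lemma alt_chain_0 N A w : alt_chain N 0 A w = divpow A w.
Proof.
  unfold alt_chain; rewrite Rsum_eq_0 by (intros; rewrite !comp_poly_0; ring).
  unfold alt_exp, den; rewrite comp_poly_0; simpl.
  replace (- (2 * 0 - 0) * w) with 0 by ring. rewrite exp_0; ring.
Qed.

Lemma alt_chain_S N B A w :
  alt_chain N (S B) A w = \sum_(i < N) alt_exp (S B) (S i) w * comp_term_poly B A i w.
Proof.
  unfold alt_chain; rewrite comp_poly_S_0, Rmult_0_r, Rplus_0_l.
  apply Rsum_ext; intros i _; now rewrite comp_poly_S_increment.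
Qed.

Lemma alt_chain_S_at_0 N B A :
  alt_chain N (S B) A 0 = \sum_(i < N) (-1) ^ S i * comp_term B A i.
Proof.
  rewrite alt_chain_S; apply Rsum_ext; intros i _.
  unfold alt_exp, comp_term_poly; rewrite exp_conv_at_0, Rmult_0_r, exp_0; ring.
Qed.

Lemma is_derive_alt_chain N B A w :
  is_derive (alt_chain N (S B) A) w (/ cosh w * (alt_chain N B A w - alt_tail N B A w)).
Proof.
  apply is_derive_ext with
    (fun w => \sum_(i < N) alt_exp (S B) (S i) w * comp_term_poly B A i w);
    [intros; symmetry; apply alt_chain_S|].
  evar_last.
  - apply is_derive_Rsum with
      (df := fun i => - (2 * alt_exp (S B) (S i) w * comp_poly B A i w)); intros i.
    apply is_derive_ext with (fun w => (-1) ^ S i *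
      (exp (- den (S B) (S i) * w) * comp_term_poly B A i w));
      [intros; unfold alt_exp; symmetry; apply Rmult_assoc|].
    evar_last; [apply is_derive_scal,
      (is_derive_exp_mult_exp_conv _ _ (fun A' => 2 * comp_sum B A' i));
      [apply den_mult_comp_term_0|intros; apply den_mult_comp_term_S]|].
    unfold alt_exp, comp_poly, exp_conv.
    rewrite (Rsum_ext _ (fun a => 2 * (comp_sum B (A - a) i * divpow a w))), Rsum_scal
      by (intros; ring); simpl; ring.
  - assert (Hc := cosh_pos w). unfold alt_chain, alt_tail.
    rewrite <- (Rsum_by_parts (fun i => alt_exp B i w) (fun i => comp_poly B A i w)), <- Rsum_scal.
    apply Rsum_ext; intros i _.
    replace (alt_exp B i w - alt_exp B (S i) w) with (- (2 * cosh w * alt_exp (S B) (S i) w))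
      by (rewrite cosh_mult_alt_exp; ring).
    field; lra.
Qed.

Lemma continuous_alt_exp r n w : continuous (alt_exp r n) w.
Proof. unfold alt_exp; auto with continuity. Qed.

Lemma continuous_comp_poly B A i w : continuous (comp_poly B A i) w.
Proof. apply (continuous_exp_conv _ A (fun y => y)), continuous_id. Qed.

Lemma continuous_alt_tail N B A w : continuous (alt_tail N B A) w.
Proof. apply continuous_Rmult; [apply continuous_alt_exp|apply continuous_comp_poly]. Qed.

Lemma Rabs_alt_chain_S_le N B A w : 0 <= w ->
  Rabs (alt_chain N (S B) A w) <= exp (- w) * comp_poly (S B) A N w.
Proof.
  intros Hw; rewrite alt_chain_S; eapply Rle_trans; [apply Rabs_Rsum_le|].
  apply Rle_trans with
    (\sum_(i < N) exp (- w) * (comp_poly (S B) A (S i) w - comp_poly (S B) A i w)).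
  - apply Rsum_le; intros i _. rewrite comp_poly_S_increment, Rabs_mult, Rabs_alt_exp.
    assert (Hterm : 0 <= comp_term_poly B A i w)
      by (apply exp_conv_nonneg; [intros; apply comp_term_nonneg|assumption]).
    rewrite (Rabs_pos_eq _ Hterm); destruct (le_lt_dec B i) as [Hi|Hi].
    + apply Rmult_le_compat_r; [assumption|].
      assert (Hd := INR_le_den B i Hi); assert (Hn := one_le_INR_S i). apply exp_le; nra.
    + replace (comp_term_poly B A i w) with 0; [lra|].
      symmetry; apply Rsum_eq_0; intros a _; rewrite comp_term_eq_0 by assumption; ring.
  - rewrite Rsum_scal, (Rsum_telescope (fun i => comp_poly (S B) A i w)), comp_poly_S_0; lra.
Qed.

Lemma is_lim_seq_alt_chain_at_INR B A : is_lim_seq (fun N => alt_chain N (S B) A (INR N)) 0.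
Proof.
  destruct (comp_poly_le (S B) A) as [C [HC0 HC]].
  apply is_lim_seq_null_le with (fun N => C * (INR (S N) * exp (- INR N / 2)));
    [exists 0%nat; intros N _|apply is_lim_seq_null_scal, is_lim_seq_INR_S_exp_half].
  eapply Rle_trans; [apply Rabs_alt_chain_S_le, pos_INR|].
  apply Rle_trans with (exp (- INR N) * (C * (INR (S N) * exp (INR N / 2)))).
  - apply Rmult_le_compat_l; [apply Rlt_le, exp_pos|].
    eapply Rle_trans; [apply HC, pos_INR|]. apply Rmult_le_compat_l; [assumption|].
    apply Rmult_le_compat_r; [apply Rlt_le, exp_pos|].
    assert (HN := one_le_INR_S N); assert (Hs := sqrt_sqrt (INR (S N)) ltac:(lra)).
    assert (Hs0 := sqrt_INR_S_pos N). nra.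
  - right; replace (- INR N / 2) with (- INR N + INR N / 2) by field. rewrite exp_plus; ring.
Qed.

Lemma Rabs_alt_tail_le B A : exists C, 0 <= C /\ forall N w, (S B <= N)%nat -> 0 <= w ->
  Rabs (alt_tail N B A w) <= C * sqrt (INR (S N)) * exp (- INR N * w).
Proof.
  destruct (comp_poly_le B A) as [C [HC0 HC]]; exists C; split; [assumption|intros N w HN Hw].
  assert (Hpoly : 0 <= comp_poly B A N w)
    by (apply exp_conv_nonneg; [intros; apply comp_sum_nonneg|assumption]).
  unfold alt_tail; rewrite Rabs_mult, Rabs_alt_exp, (Rabs_pos_eq _ Hpoly).
  apply Rle_trans with (C * sqrt (INR (S N)) * exp (- den B N * w + w / 2)).
  - rewrite exp_plus.
    replace (C * sqrt (INR (S N)) * (exp (- den B N * w) * exp (w / 2)))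
      with (exp (- den B N * w) * (C * (sqrt (INR (S N)) * exp (w / 2)))) by ring.
    apply Rmult_le_compat_l; [apply Rlt_le, exp_pos|now apply HC].
  - apply Rmult_le_compat_l; [apply Rmult_le_pos; [assumption|apply sqrt_pos]|].
    apply le_INR in HN; rewrite S_INR in HN. apply exp_le; unfold den; nra.
Qed.

Lemma is_lim_seq_RInt_alt_tail (phi : R -> R) c B A :
  (forall w, continuous phi w) -> (forall w, 0 <= w -> Rabs (phi w) <= c) ->
  is_lim_seq (fun N => RInt (fun w => phi w * alt_tail N B A w) 0 (INR N)) 0.
Proof.
  intros Hcont Hphi; destruct (Rabs_alt_tail_le B A) as [C [HC0 HC]].
  assert (Hc : 0 <= c) by (eapply Rle_trans; [apply Rabs_pos|apply (Hphi 0); lra]).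
  apply is_lim_seq_null_le with (fun N => c * C * 2 * / sqrt (INR (S N)));
    [exists (S B); intros N HN|apply is_lim_seq_null_scal, is_lim_seq_inv_sqrt_INR_S].
  assert (HN' : 1 <= INR N) by (apply (le_INR 1); lia).
  apply Rle_trans with (c * C * sqrt (INR (S N)) / INR N).
  - apply RInt_abs_le_exp; [|lra|lra|].
    + intros w; apply continuous_Rmult; [apply Hcont|apply continuous_alt_tail].
    + intros w [Hw _]; rewrite Rabs_mult, (Rmult_assoc c), Rmult_assoc.
      apply Rmult_le_compat; [apply Rabs_pos|apply Rabs_pos|now apply Hphi|now apply HC].
  - unfold Rdiv; rewrite !(Rmult_assoc (c * C)).
    apply Rmult_le_compat_l; [now apply Rmult_le_pos|].
    rewrite <- sqrt_INR_S_div; unfold Rdiv; rewrite (Rmult_comm 2), Rmult_assoc.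
    apply Rmult_le_compat_l; [apply sqrt_pos|].
    rewrite S_INR; apply Rmult_le_reg_r with (INR N * (INR N + 1)); [nra|].
    replace (/ INR N * (INR N * (INR N + 1))) with (INR N + 1) by (field; lra).
    replace (/ (INR N + 1) * 2 * (INR N * (INR N + 1))) with (2 * INR N) by (field; lra). lra.
Qed.

Lemma is_derive_divpow_S_gd b w :
  is_derive (fun w => divpow (S b) (gd w)) w (/ cosh w * divpow b (gd w)).
Proof.
  exact (is_derive_comp (divpow (S b)) gd w _ _ (is_derive_divpow_S b (gd w)) (is_derive_gd w)).
Qed.

Lemma is_derive_gd_alternating_sum (f e : nat -> R -> R) n w :
  (forall b, (b <= n)%nat -> is_derive (f b) w (/ cosh w * (f (S b) w - e b w))) ->
  is_derive (fun w => \sum_(b < S n) (-1) ^ b * (divpow b (gd w) * f b w)) w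
    (/ cosh w * ((-1) ^ n * (divpow n (gd w) * f (S n) w) -
                 \sum_(b < S n) (-1) ^ b * (divpow b (gd w) * e b w))).
Proof.
  induction n as [|n IH]; intros Hf.
  - apply is_derive_ext with (f 0%nat).
    { intros y; rewrite Rsum_S, divpow_0; simpl. rewrite !Rmult_1_l; symmetry; apply Rplus_0_l. }
    evar_last; [now apply Hf|]. rewrite Rsum_S, !divpow_0; simpl; ring.
  - apply is_derive_ext with (fun w => \sum_(b < S n) (-1) ^ b * (divpow b (gd w) * f b w) +
      (-1) ^ S n * (divpow (S n) (gd w) * f (S n) w)); [intros; now rewrite (Rsum_S _ (S n))|].
    evar_last.
    + apply is_derive_Rplus; [apply IH; intros; apply Hf; lia|].
      apply is_derive_scal, is_derive_Rmult; [apply is_derive_divpow_S_gd|now apply Hf].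
    + rewrite (Rsum_S _ (S n)); simpl pow; ring.
Qed.

(* By telescoping, an antiderivative of [divpow B (gd w) * divpow A w / cosh w] up to a sign and
   the truncation error [gd_tail]. *)
Definition gd_chain (N B A : nat) (w : R) : R :=
  \sum_(b < S B) (-1) ^ b * (divpow b (gd w) * alt_chain N (S B - b) A w).

Definition gd_tail (N B A : nat) (w : R) : R :=
  \sum_(b < S B) (-1) ^ b * (divpow b (gd w) * alt_tail N (B - b) A w).

Lemma is_derive_gd_chain N B A w :
  is_derive (gd_chain N B A) w
    (/ cosh w * ((-1) ^ B * (divpow B (gd w) * divpow A w) - gd_tail N B A w)).
Proof.
  rewrite <- (alt_chain_0 N A w), <- (Nat.sub_diag (S B)).
  apply (is_derive_gd_alternating_sum (fun b => alt_chain N (S B - b) A)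
    (fun b => alt_tail N (B - b) A)).
  intros b Hb; rewrite Nat.sub_succ, Nat.sub_succ_l by assumption; apply is_derive_alt_chain.
Qed.

Lemma gd_chain_at_0 N B A : gd_chain N B A 0 = \sum_(i < N) (-1) ^ S i * comp_term B A i.
Proof.
  unfold gd_chain; rewrite gd_0, Rsum_S_first, Rsum_eq_0, divpow_0, Nat.sub_0_r, alt_chain_S_at_0.
  - simpl; ring.
  - intros b _; rewrite divpow_S_at_0; ring.
Qed.

Lemma divpow_gd_bounds b w : 0 <= w -> 0 <= divpow b (gd w) <= divpow b (PI / 2).
Proof.
  intros Hw; assert (Hg := gd_bounds w Hw).
  split; [now apply divpow_nonneg|now apply divpow_incr].
Qed.

Lemma is_lim_seq_gd_chain_at_INR B A : is_lim_seq (fun N => gd_chain N B A (INR N)) 0.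
Proof.
  apply is_lim_seq_null_Rsum; intros b Hb; apply in_seq in Hb; apply is_lim_seq_null_scal.
  apply is_lim_seq_null_le with (fun N =>
    divpow b (PI / 2) * Rabs (alt_chain N (S B - b) A (INR N))).
  - exists 0%nat; intros N _; rewrite Rabs_mult.
    assert (Hb' := divpow_gd_bounds b (INR N) (pos_INR N)).
    apply Rmult_le_compat_r; [apply Rabs_pos|rewrite Rabs_pos_eq; apply Hb'].
  - replace (S B - b)%nat with (S (B - b)) by lia.
    apply is_lim_seq_null_scal, (is_lim_seq_abs_0 (fun N => alt_chain N (S (B - b)) A (INR N))).
    apply is_lim_seq_alt_chain_at_INR.
Qed.

Lemma continuous_gd_tail N B A w : continuous (gd_tail N B A) w.
Proof.
  apply continuous_Rsum; intros b.
  apply continuous_Rmult; [apply continuous_const|].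
  apply continuous_Rmult; [auto with continuity|apply continuous_alt_tail].
Qed.

Lemma is_lim_seq_RInt_gd_tail B A :
  is_lim_seq (fun N => RInt (fun w => / cosh w * gd_tail N B A w) 0 (INR N)) 0.
Proof.
  set (phi := fun b w => (-1) ^ b * (/ cosh w * divpow b (gd w))).
  assert (Hphi : forall b w, continuous (phi b) w) by (intros; unfold phi; auto with continuity).
  apply is_lim_seq_ext with (fun N =>
    \sum_(b < S B) RInt (fun w => phi b w * alt_tail N (B - b) A w) 0 (INR N)).
  - intros N; rewrite <- RInt_Rsum
      by (intros; apply continuous_Rmult; [apply Hphi|apply continuous_alt_tail]).
    apply RInt_ext; intros w _; unfold gd_tail; rewrite <- Rsum_scal.
    apply Rsum_ext; intros b _; unfold phi; ring.
  - apply is_lim_seq_null_Rsum; intros b _.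
    apply is_lim_seq_RInt_alt_tail with (divpow b (PI / 2)); [apply Hphi|intros w Hw].
    assert (Hb := divpow_gd_bounds b w Hw); assert (Hpos := inv_cosh_pos w).
    assert (Hle := inv_cosh_le_1 w).
    unfold phi; rewrite Rabs_mult, pow_1_abs, Rmult_1_l, Rabs_pos_eq; nra.
Qed.

Lemma is_lim_seq_RInt_W A B :
  is_lim_seq (fun N =>
    (-1) ^ S B * RInt (fun w => / cosh w * (divpow B (gd w) * divpow A w)) 0 (INR N))
    (W (A + S B) (S B)).
Proof.
  set (main := fun w => / cosh w * (divpow B (gd w) * divpow A w)).
  set (error := fun N w => / cosh w * gd_tail N B A w).
  assert (Hmain : forall w, continuous main w) by (intros; unfold main; auto with continuity).
  assert (Herror : forall N w, continuous (error N) w)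
    by (intros; apply continuous_Rmult; [auto with continuity|apply continuous_gd_tail]).
  assert (Hftc : forall N, (-1) ^ B * RInt main 0 (INR N) - RInt (error N) 0 (INR N) =
    gd_chain N B A (INR N) - gd_chain N B A 0).
  { intros N; rewrite <- RInt_Rscal, <- RInt_Rminus by auto with continuity.
    apply RInt_of_is_derive; [auto with continuity|intros w].
    evar_last; [apply is_derive_gd_chain|unfold main, error; ring]. }
  assert (Hlim := is_lim_seq_minus' _ _ _ _ (is_lim_seq_W B A)
    (is_lim_seq_plus' _ _ _ _ (is_lim_seq_gd_chain_at_INR B A) (is_lim_seq_RInt_gd_tail B A))).
  rewrite Rplus_0_r, Rminus_0_r in Hlim. eapply is_lim_seq_ext; [|exact Hlim].
  intros N; specialize (Hftc N); rewrite gd_chain_at_0 in Hftc.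
  rewrite <- (tech_pow_Rmult _ B); fold (error N); lra.
Qed.

(** * The coefficients [Zjp] *)

Lemma incr_lists_nil len lo hi : (S hi - lo < len)%nat -> incr_lists len lo hi = [].
Proof.
  revert lo; induction len as [|len IH]; intros lo H; [lia|].
  cbn [incr_lists]. assert (Hlo : forall a, In a (seq lo (S hi - lo)) -> (lo <= a <= hi)%nat)
    by (intros a Ha; apply in_seq in Ha; lia).
  induction (seq lo (S hi - lo)) as [|a l IHl]; [reflexivity|].
  cbn [flat_map]; specialize (Hlo a (or_introl eq_refl)) as Ha.
  rewrite IH by lia; apply IHl; intros; apply Hlo; now right.
Qed.

Definition zetabar_chain_sum (k j p : nat) : R :=
  \sum_(mids <- incr_lists k (S j) (p - 1)) chain_prod j (mids ++ [p]).

Lemma zetabar_chain_sum_0 j p : zetabar_chain_sum 0 j p = zetabar (2 * p - 2 * j).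
Proof. unfold zetabar_chain_sum, Rsum_list; simpl; ring. Qed.

Lemma zetabar_chain_sum_S k j d :
  zetabar_chain_sum (S k) j (j + S d) =
  \sum_(i < d) zetabar (2 * S i) * zetabar_chain_sum k (j + S i) (j + S d).
Proof.
  unfold zetabar_chain_sum at 1; cbn [incr_lists]; rewrite Rsum_flat_map, Rsum_seq.
  replace (S (j + S d - 1) - S j)%nat with d by lia; apply Rsum_ext; intros i _.
  replace (2 * S i)%nat with (2 * (S j + i) - 2 * j)%nat by lia.
  replace (j + S i)%nat with (S j + i)%nat by lia.
  unfold zetabar_chain_sum; rewrite map_map, <- Rsum_scal; reflexivity.
Qed.

Lemma Zjp_zetabar_chain_sum j p n : (j < p)%nat -> (p - j <= n)%nat ->
  Zjp j p = \sum_(k < n) (-2) ^ S k * zetabar_chain_sum k j p.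
Proof.
  intros Hjp Hn; unfold Zjp; destruct (Nat.eqb_spec j p); [lia|].
  rewrite Rsum_seq, (Rsum_extend _ (p - j) n); [|assumption|].
  - apply Rsum_ext; intros k _; unfold zetabar_chain_sum.
    replace (1 + k - 1)%nat with k by lia; reflexivity.
  - intros k Hk; unfold zetabar_chain_sum; rewrite incr_lists_nil by lia.
    unfold Rsum_list; simpl; ring.
Qed.

Lemma Zjp_diag p : Zjp p p = 1.
Proof. unfold Zjp; now rewrite Nat.eqb_refl. Qed.

Lemma Zjp_rec j d :
  Zjp j (j + S d) = -2 * \sum_(i < S d) zetabar (2 * S i) * Zjp (j + S i) (j + S d).
Proof.
  rewrite (Zjp_zetabar_chain_sum j _ (S d)), Rsum_S_first, zetabar_chain_sum_0 by lia.
  rewrite (Rsum_ext _ (fun k => \sum_(i < d)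
    -2 * (zetabar (2 * S i) * ((-2) ^ S k * zetabar_chain_sum k (j + S i) (j + S d))))).
  - rewrite Rsum_exchange, Rsum_S, Rmult_plus_distr_l, Rplus_comm, Zjp_diag.
    replace (2 * (j + S d) - 2 * j)%nat with (2 * S d)%nat by lia.
    f_equal; [|simpl; ring].
    rewrite <- Rsum_scal; apply Rsum_ext_lt; intros i Hi.
    rewrite !Rsum_scal, <- Zjp_zetabar_chain_sum by lia; reflexivity.
  - intros k _; rewrite zetabar_chain_sum_S, <- Rsum_scal; apply Rsum_ext; intros i _.
    rewrite <- (tech_pow_Rmult _ (S k)); ring.
Qed.

Lemma Zjp_shift j d : Zjp j (j + d) = Zjp 0 d.
Proof.
  revert j; induction d as [d IH] using (well_founded_induction lt_wf); intros j.
  destruct d as [|d]; [now rewrite Nat.add_0_r, !Zjp_diag|].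
  rewrite Zjp_rec; change (Zjp 0 (S d)) with (Zjp 0 (0 + S d)); rewrite Zjp_rec.
  f_equal; apply Rsum_ext_lt; intros i Hi; f_equal.
  replace (j + S d)%nat with (j + S i + (d - i))%nat by lia.
  replace (0 + S d)%nat with (0 + S i + (d - i))%nat by lia.
  rewrite !IH by lia; reflexivity.
Qed.

Definition zcoef (d : nat) : R := Zjp 0 d.

Lemma Zjp_zcoef j p : (j <= p)%nat -> Zjp j p = zcoef (p - j).
Proof. intros H; replace p with (j + (p - j))%nat at 1 by lia; apply Zjp_shift. Qed.

Lemma zcoef_0 : zcoef 0 = 1.
Proof. apply Zjp_diag. Qed.

Lemma zcoef_S d : zcoef (S d) = -2 * \sum_(i < S d) zetabar (2 * S i) * zcoef (d - i).
Proof.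
  unfold zcoef; change (Zjp 0 (S d)) with (Zjp 0 (0 + S d)); rewrite Zjp_rec.
  f_equal; apply Rsum_ext_lt; intros i Hi; f_equal.
  replace (0 + S d)%nat with (0 + S i + (d - i))%nat by lia; apply Zjp_shift.
Qed.

Lemma is_lim_seq_zetabar s : (1 <= s)%nat ->
  is_lim_seq (fun N => \sum_(n < N) (-1) ^ n * / INR (S n) ^ s) (zetabar s).
Proof.
  intros Hs.
  assert (Hpos : forall i, 0 < INR (S i)) by (intros i; apply lt_0_INR; lia).
  destruct (ex_finite_lim_alternating (fun n => / INR (S n) ^ s)) as [l Hl].
  - apply is_lim_seq_null_le with (fun n => / INR (S n));
      [|apply (is_lim_seq_incr_1 (fun n => / INR n)), is_lim_seq_inv_INR].
    exists 0%nat; intros n _; rewrite Rabs_pos_eq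
      by now apply Rlt_le, Rinv_0_lt_compat, pow_lt.
    apply Rinv_le_contravar; [apply Hpos|].
    rewrite <- (pow_1 (INR (S n))) at 1; apply Rle_pow; [apply one_le_INR_S|assumption].
  - intros n; apply Rinv_le_contravar; [now apply pow_lt|].
    apply pow_incr; split; [apply Rlt_le, Hpos|apply le_INR; lia].
  - replace (zetabar s) with l; [exact Hl|]. destruct s as [|s]; [lia|].
    unfold zetabar; erewrite Lim_seq_ext; [now rewrite (is_lim_seq_unique _ _ Hl)|].
    intros N; rewrite Rsum_seq; apply Rsum_ext; intros n _.
    now replace (1 + n - 1)%nat with n by lia.
Qed.

(** * Fourier series of the odd powers *)

Definition sin_sum (N s : nat) (v : R) : R :=
  2 * \sum_(n < N) (-1) ^ n * (sin (INR (S n) * v) / INR (S n) ^ s).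

Definition cos_sum (N s : nat) (v : R) : R :=
  2 * \sum_(n < N) (-1) ^ n * (cos (INR (S n) * v) / INR (S n) ^ s).

Lemma is_derive_sin_sum N s v : is_derive (sin_sum N (S s)) v (cos_sum N s v).
Proof.
  apply is_derive_scal, is_derive_Rsum; intros n; apply is_derive_scal.
  assert (Hn : INR (S n) <> 0) by (apply not_0_INR; lia).
  rewrite <- tech_pow_Rmult; generalize (pow_nonzero _ s Hn).
  revert Hn; generalize (INR (S n) ^ s) (INR (S n)); intros y x Hx Hy.
  auto_derive; [trivial|]. field; auto.
Qed.

Lemma is_derive_cos_sum N s v : is_derive (cos_sum N (S s)) v (- sin_sum N s v).
Proof.
  unfold sin_sum; rewrite Ropp_mult_distr_r, <- Rsum_opp.
  apply is_derive_scal, is_derive_Rsum; intros n; rewrite Ropp_mult_distr_r; apply is_derive_scal.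
  assert (Hn : INR (S n) <> 0) by (apply not_0_INR; lia).
  rewrite <- tech_pow_Rmult; generalize (pow_nonzero _ s Hn).
  revert Hn; generalize (INR (S n) ^ s) (INR (S n)); intros y x Hx Hy.
  auto_derive; [trivial|]. field; auto.
Qed.

Lemma sin_sum_at_0 N s : sin_sum N s 0 = 0.
Proof.
  unfold sin_sum; rewrite Rsum_eq_0; [ring|intros n _].
  rewrite Rmult_0_r, sin_0; unfold Rdiv; ring.
Qed.

Lemma is_lim_seq_cos_sum_at_0 s : (1 <= s)%nat ->
  is_lim_seq (fun N => cos_sum N s 0) (2 * zetabar s).
Proof.
  intros Hs; apply (is_lim_seq_scal_l _ 2 (zetabar s)).
  eapply is_lim_seq_ext; [|now apply is_lim_seq_zetabar].
  intros N; apply Rsum_ext; intros n _; rewrite Rmult_0_r, cos_0; unfold Rdiv; ring.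
Qed.

Lemma alternating_dirichlet_kernel N v :
  cos (v / 2) * (1 - cos_sum N 0 v) = (-1) ^ N * cos ((INR N + / 2) * v).
Proof.
  unfold cos_sum; induction N as [|N IH].
  - simpl; unfold Rsum_list; simpl. replace ((0 + / 2) * v) with (v / 2) by field. ring.
  - rewrite Rsum_S, <- tech_pow_Rmult.
    replace ((INR N + / 2) * v) with (INR (S N) * v - v / 2) in IH by (rewrite S_INR; field).
    replace ((INR (S N) + / 2) * v) with (INR (S N) * v + v / 2) by field.
    rewrite cos_minus in IH; rewrite cos_plus, pow_O, Rdiv_1_r.
    rewrite (Rmult_plus_distr_l 2), Rminus_plus_distr, Rmult_minus_distr_l, IH; ring.
Qed.

Lemma Rabs_sin_le_1 x : Rabs (sin x) <= 1.
Proof. apply Rabs_le, SIN_bound. Qed.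

(* Compare [f] with [f - sin (L x) g x / L], whose derivative has no factor [L]. *)
Lemma Rabs_diff_le_of_oscillating_derivative (f g g' : R -> R) L G K v :
  0 < L -> 0 <= v ->
  (forall x, 0 <= x <= v -> is_derive f x (cos (L * x) * g x)) ->
  (forall x, 0 <= x <= v -> is_derive g x (g' x)) ->
  (forall x, 0 <= x <= v -> Rabs (g' x) <= K) -> Rabs (g v) <= G ->
  Rabs (f v - f 0) <= (G + K * v) / L.
Proof.
  intros HL Hv Hf Hg HK HG.
  set (h := fun x => f x - / L * (sin (L * x) * g x)).
  assert (Hh : Rabs (h v - h 0) <= K / L * Rabs (v - 0)).
  { apply Rabs_diff_le_of_is_derive with (fun x => - (/ L * (sin (L * x) * g' x)));
      intros x; rewrite Rmin_left, Rmax_right by assumption; intros Hx.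
    - evar_last; [apply is_derive_Rminus; [now apply Hf|]; apply is_derive_scal, is_derive_Rmult;
        [|now apply Hg]|].
      + instantiate (1 := L * cos (L * x)); auto_derive; [trivial|ring].
      + simpl; field; lra.
    - rewrite Rabs_Ropp, !Rabs_mult, (Rabs_pos_eq (/ L)) by now apply Rlt_le, Rinv_0_lt_compat.
      unfold Rdiv; rewrite Rmult_comm; apply Rmult_le_compat_r;
        [now apply Rlt_le, Rinv_0_lt_compat|].
      rewrite <- (Rmult_1_l K); apply Rmult_le_compat;
        [apply Rabs_pos|apply Rabs_pos|apply Rabs_sin_le_1|now apply HK]. }
  replace (f v - f 0) with (h v - h 0 + / L * (sin (L * v) * g v))
    by (unfold h; rewrite Rmult_0_r, sin_0; ring).
  rewrite Rminus_0_r, (Rabs_pos_eq v) in Hh by assumption.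
  assert (HiL := Rinv_0_lt_compat L HL).
  assert (Hg1 : Rabs (/ L * (sin (L * v) * g v)) <= / L * (1 * G)).
  { rewrite !Rabs_mult, (Rabs_pos_eq (/ L)) by lra. apply Rmult_le_compat_l; [lra|].
    apply Rmult_le_compat; [apply Rabs_pos|apply Rabs_pos|apply Rabs_sin_le_1|assumption]. }
  eapply Rle_trans; [apply Rabs_triang|]. unfold Rdiv in *; lra.
Qed.

Lemma half_le_cos_half_sqr x : 0 <= x <= PI / 2 -> / 2 <= cos (x / 2) * cos (x / 2).
Proof.
  intros Hx; assert (Hdouble := cos_2a_cos (x / 2)).
  replace (2 * (x / 2)) with x in Hdouble by field.
  assert (0 <= cos x) by (apply cos_ge_0; lra). lra.
Qed.

Lemma half_le_cos_half x : 0 <= x <= PI / 2 -> / 2 <= cos (x / 2).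
Proof.
  intros Hx; assert (Hsqr := half_le_cos_half_sqr x Hx); assert (HPI := PI_RGT_0).
  assert (0 < cos (x / 2)) by (apply cos_gt_0; lra). assert (Hb := COS_bound (x / 2)). nra.
Qed.

Lemma unif_null_sin_sum_1 :
  unif_null (fun v => 0 <= v <= PI / 2) (fun N v => sin_sum N 1 v - v).
Proof.
  exists (fun N => 4 * / INR N); split; [apply is_lim_seq_null_scal, is_lim_seq_inv_INR|].
  exists 1%nat; intros N HN v Hv; apply (le_INR 1) in HN; simpl (INR 1) in HN.
  set (L := INR N + / 2).
  assert (Hcos : forall x, 0 <= x <= v -> 0 < cos (x / 2))
    by (intros x Hx; assert (Hhalf := half_le_cos_half x ltac:(lra)); lra).
  assert (Hosc : Rabs ((sin_sum N 1 v - v) - (sin_sum N 1 0 - 0)) <= (2 + 1 * v) / L).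
  { apply (Rabs_diff_le_of_oscillating_derivative (fun v => sin_sum N 1 v - v)
      (fun x => - (-1) ^ N * / cos (x / 2))
      (fun x => - (-1) ^ N * (sin (x / 2) / (2 * (cos (x / 2) * cos (x / 2))))));
      [unfold L; lra|lra| | | |].
    - intros x Hx; assert (Hc := Hcos x Hx). evar_last;
        [apply (is_derive_Rminus (sin_sum N 1)); [apply is_derive_sin_sum|apply (is_derive_id x)]|].
      assert (HD := alternating_dirichlet_kernel N x); fold L in HD.
      change (@one R_AbsRing) with 1; simpl.
      apply Rmult_eq_reg_l with (cos (x / 2)); [|lra].
      transitivity (- (cos (x / 2) * (1 - cos_sum N 0 x))); [ring|]. rewrite HD; field; lra.
    - intros x Hx; assert (Hc := Hcos x Hx). apply is_derive_scal.
      auto_derive; [lra|unfold Rdiv; simpl; field; lra].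
    - intros x Hx; rewrite Rabs_mult, Rabs_Ropp, pow_1_abs, Rmult_1_l.
      assert (Hc2 := half_le_cos_half_sqr x ltac:(lra)).
      unfold Rdiv; rewrite Rabs_mult, <- (Rmult_1_l 1), (Rabs_pos_eq (/ _))
        by (apply Rlt_le, Rinv_0_lt_compat; lra).
      apply Rmult_le_compat; [apply Rabs_pos| |apply Rabs_sin_le_1|].
      + apply Rlt_le, Rinv_0_lt_compat; lra.
      + rewrite <- Rinv_1; apply Rinv_le_contravar; lra.
    - assert (Hc := half_le_cos_half v Hv).
      rewrite Rabs_mult, Rabs_Ropp, pow_1_abs, Rmult_1_l.
      rewrite Rabs_pos_eq by (apply Rlt_le, Rinv_0_lt_compat; lra).
      apply Rle_trans with (/ / 2); [apply Rinv_le_contravar; lra|rewrite Rinv_inv; lra]. }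
  rewrite sin_sum_at_0, Rminus_diag, Rminus_0_r in Hosc.
  eapply Rle_trans; [exact Hosc|]. assert (HPI := PI_4).
  apply Rmult_le_compat; [lra|apply Rlt_le, Rinv_0_lt_compat; unfold L; lra|lra|].
  apply Rinv_le_contravar; unfold L; lra.
Qed.

Definition odd_power_error (m N : nat) (v : R) : R :=
  \sum_(i < S m) zcoef (m - i) * sin_sum N (2 * i + 1) v - (-1) ^ m * divpow (2 * m + 1) v.

(* Differentiating twice gives [- odd_power_error m]: this drives the induction on [m]. *)
Definition odd_power_error_tail (m N : nat) (v : R) : R :=
  zcoef (S m) * v + \sum_(i < S m) zcoef (m - i) * sin_sum N (2 * i + 3) v +
  (-1) ^ m * divpow (2 * m + 3) v.

Definition even_power_error (m N : nat) (v : R) : R :=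
  zcoef (S m) + \sum_(i < S m) zcoef (m - i) * cos_sum N (2 * i + 2) v +
  (-1) ^ m * divpow (2 * m + 2) v.

Lemma odd_power_error_0 N v : odd_power_error 0 N v = sin_sum N 1 v - v.
Proof.
  unfold odd_power_error; rewrite Rsum_1; simpl (_ - _)%nat; simpl (2 * 0 + 1)%nat.
  rewrite zcoef_0, divpow_1; ring.
Qed.

Lemma odd_power_error_S m N v :
  odd_power_error (S m) N v = zcoef (S m) * odd_power_error 0 N v + odd_power_error_tail m N v.
Proof.
  rewrite odd_power_error_0; unfold odd_power_error, odd_power_error_tail.
  rewrite (Rsum_S_first _ (S m)), <- tech_pow_Rmult.
  replace (2 * S m + 1)%nat with (2 * m + 3)%nat by lia.
  rewrite (Rsum_ext _ (fun i => zcoef (m - i) * sin_sum N (2 * i + 3) v)); [simpl; ring|].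
  intros i _; now replace (2 * S i + 1)%nat with (2 * i + 3)%nat by lia.
Qed.

Lemma is_derive_odd_power_error_tail m N v :
  is_derive (odd_power_error_tail m N) v (even_power_error m N v).
Proof.
  apply is_derive_Rplus; [apply is_derive_Rplus|].
  - auto_derive; [trivial|ring].
  - apply is_derive_Rsum; intros i; apply is_derive_scal.
    rewrite !Nat.add_succ_r; apply is_derive_sin_sum.
  - apply is_derive_scal; rewrite !Nat.add_succ_r; apply is_derive_divpow_S.
Qed.

Lemma is_derive_even_power_error m N v :
  is_derive (even_power_error m N) v (- odd_power_error m N v).
Proof.
  evar_last.
  - apply is_derive_Rplus; [apply is_derive_Rplus; [apply (is_derive_const (zcoef (S m)))|]|].
    + apply is_derive_Rsum; intros i; apply is_derive_scal.
      rewrite Nat.add_succ_r; apply is_derive_cos_sum.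
    + apply is_derive_scal; rewrite Nat.add_succ_r; apply is_derive_divpow_S.
  - unfold odd_power_error. change (@zero R_NormedModule) with 0.
    rewrite (Rsum_ext _ (fun i => - (zcoef (m - i) * sin_sum N (2 * i + 1) v))), Rsum_opp
      by (intros; ring).
    simpl; ring.
Qed.

Lemma is_lim_seq_even_power_error_at_0 m : is_lim_seq (fun N => even_power_error m N 0) 0.
Proof.
  assert (Hlim : is_lim_seq
    (fun N => zcoef (S m) + \sum_(i < S m) zcoef (m - i) * cos_sum N (2 * S i) 0)
    (zcoef (S m) + \sum_(i < S m) zcoef (m - i) * (2 * zetabar (2 * S i)))).
  { apply is_lim_seq_plus'; [apply is_lim_seq_const|].
    apply (is_lim_seq_Rsum (fun i N => zcoef (m - i) * cos_sum N (2 * S i) 0)); intros i _.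
    apply (is_lim_seq_scal_l _ (zcoef (m - i)) (2 * zetabar (2 * S i))).
    apply is_lim_seq_cos_sum_at_0; lia. }
  assert (Hzero : zcoef (S m) + \sum_(i < S m) zcoef (m - i) * (2 * zetabar (2 * S i)) = 0)
    by (rewrite zcoef_S, <- Rsum_scal, <- Rsum_plus; apply Rsum_eq_0; intros; ring).
  rewrite Hzero in Hlim; eapply is_lim_seq_ext; [|exact Hlim].
  intros N; unfold even_power_error; rewrite (Nat.add_succ_r (2 * m)), divpow_S_at_0.
  rewrite (Rsum_ext _ (fun i => zcoef (m - i) * cos_sum N (2 * i + 2) 0)); [ring|].
  intros i _; now replace (2 * S i)%nat with (2 * i + 2)%nat by lia.
Qed.

Lemma unif_null_odd_power_error m :
  unif_null (fun v => 0 <= v <= PI / 2) (odd_power_error m).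
Proof.
  assert (Hbase : unif_null (fun v => 0 <= v <= PI / 2) (odd_power_error 0)).
  { eapply unif_null_ext; [|exact unif_null_sin_sum_1]. intros N v _.
    symmetry; apply odd_power_error_0. }
  induction m as [|m IH]; [assumption|].
  eapply unif_null_ext; [intros; symmetry; apply odd_power_error_S|].
  apply unif_null_plus; [now apply unif_null_scal|].
  apply unif_null_of_is_derive with (even_power_error m);
    [apply is_derive_odd_power_error_tail| |].
  { apply is_lim_seq_ext with (fun _ => 0); [intros N|apply is_lim_seq_const].
    unfold odd_power_error_tail; rewrite !Nat.add_succ_r, divpow_S_at_0, Rsum_eq_0; [ring|].
    intros i _; rewrite sin_sum_at_0; ring. }
  apply unif_null_of_is_derive with (fun N v => -1 * odd_power_error m N v);
    [|apply is_lim_seq_even_power_error_at_0|now apply unif_null_scal].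
  intros N v; replace (-1 * odd_power_error m N v) with (- odd_power_error m N v) by ring.
  apply is_derive_even_power_error.
Qed.

(** * The Poisson kernel *)

(* [sin v / (cosh t + cos v)] at [v = gd w]. *)
Definition poisson (t w : R) : R := sinh w * / (cosh t * cosh w + 1).

Definition poisson_sum (N : nat) (t v : R) : R :=
  2 * \sum_(n < N) (-1) ^ n * (sin (INR (S n) * v) * exp (- INR (S n) * t)).

Lemma cosh_mult_cosh_plus_1_pos t w : 0 < cosh t * cosh w + 1.
Proof. assert (Ht := cosh_pos t); assert (Hw := cosh_pos w); nra. Qed.

#[local] Hint Resolve cosh_mult_cosh_plus_1_pos : continuity.

Lemma continuous_poisson {U : UniformSpace} (f g : U -> R) x :
  continuous f x -> continuous g x -> continuous (fun y => poisson (f y) (g y)) x.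
Proof. intros; unfold poisson; auto 10 with continuity. Qed.

Lemma continuous_poisson_sum {U : UniformSpace} N v (f : U -> R) x :
  continuous f x -> continuous (fun y => poisson_sum N (f y) v) x.
Proof. intros; unfold poisson_sum; auto 10 with continuity. Qed.

#[local] Hint Resolve continuous_poisson continuous_poisson_sum : continuity.

Lemma poisson_gd t w : (cosh t + cos (gd w)) * poisson t w = sin (gd w).
Proof.
  rewrite cos_gd, sin_gd; unfold poisson.
  assert (Hden := cosh_mult_cosh_plus_1_pos t w); assert (Hcosh := cosh_pos w). field; lra.
Qed.

Lemma poisson_sum_closed_form N t v :
  (cosh t + cos v) * poisson_sum N t v =
  sin v - (-1) ^ N * (exp (- INR N * t) * sin (INR (S N) * v) +
                      exp (- INR (S N) * t) * sin (INR N * v)).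
Proof.
  unfold poisson_sum; induction N as [|N IH].
  - simpl; unfold Rsum_list; simpl.
    rewrite !Rmult_0_l, sin_0, Ropp_0, Rmult_0_l, exp_0, !Rmult_1_l; ring.
  - assert (Hexp : 2 * cosh t * exp (- INR (S N) * t) =
      exp (- INR N * t) + exp (- INR (S (S N)) * t)).
    { replace (- INR N * t) with (t + - INR (S N) * t) by (rewrite S_INR; ring).
      replace (- INR (S (S N)) * t) with (- t + - INR (S N) * t) by (rewrite !S_INR; ring).
      rewrite !exp_plus; unfold cosh; field. }
    assert (Hsin : 2 * sin (INR (S N) * v) * cos v = sin (INR (S (S N)) * v) + sin (INR N * v)).
    { replace (INR (S (S N)) * v) with (INR (S N) * v + v) by (rewrite !S_INR; ring).
      replace (INR N * v) with (INR (S N) * v - v) by (rewrite S_INR; ring).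
      rewrite sin_plus, sin_minus; ring. }
    rewrite Rsum_S, <- tech_pow_Rmult, Rmult_plus_distr_l, Rmult_plus_distr_l, IH.
    transitivity (sin v - (-1) ^ N * (exp (- INR N * t) * sin (INR (S N) * v) +
      exp (- INR (S N) * t) * sin (INR N * v)) +
      (-1) ^ N * (2 * cosh t * exp (- INR (S N) * t) * sin (INR (S N) * v) +
        exp (- INR (S N) * t) * (2 * sin (INR (S N) * v) * cos v))); [ring|].
    rewrite Hexp, Hsin; ring.
Qed.

Lemma Rabs_poisson_remainder_le N t w : 0 <= t ->
  Rabs (poisson t w - poisson_sum N t (gd w)) <= 2 * exp (- INR N * t).
Proof.
  intros Ht; assert (Heq := poisson_sum_closed_form N t (gd w)); rewrite <- (poisson_gd t) in Heq.
  assert (Hden : 1 <= cosh t + cos (gd w)).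
  { rewrite cos_gd; assert (Hcosh := cosh_ge_1 t); assert (Hsech := inv_cosh_pos w); lra. }
  set (r := poisson t w - poisson_sum N t (gd w)).
  assert (Hr : Rabs ((cosh t + cos (gd w)) * r) <= 2 * exp (- INR N * t)).
  { replace ((cosh t + cos (gd w)) * r) with ((-1) ^ N *
      (exp (- INR N * t) * sin (INR (S N) * gd w) + exp (- INR (S N) * t) * sin (INR N * gd w)))
      by (unfold r; lra).
    rewrite Rabs_mult, pow_1_abs, Rmult_1_l; eapply Rle_trans; [apply Rabs_triang|].
    rewrite !Rabs_mult, !(Rabs_pos_eq (exp _)) by apply Rlt_le, exp_pos.
    replace (2 * exp (- INR N * t)) with (exp (- INR N * t) * 1 + exp (- INR N * t) * 1) by ring.
    apply Rplus_le_compat; (apply Rmult_le_compat;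
      [apply Rlt_le, exp_pos|apply Rabs_pos| |apply Rabs_sin_le_1]); [apply Rle_refl|].
    apply exp_le; rewrite S_INR; nra. }
  rewrite Rabs_mult, Rabs_pos_eq in Hr by lra. assert (Hr0 := Rabs_pos r). nra.
Qed.

Lemma poisson_bounds t w : 0 <= w -> 0 <= poisson t w <= 2 * exp (- t).
Proof.
  intros Hw; assert (Ht := cosh_pos t); assert (Hden := cosh_mult_cosh_plus_1_pos t w).
  assert (Hs := sinh_bounds w Hw); unfold poisson; split.
  - apply Rmult_le_pos; [lra|now apply Rlt_le, Rinv_0_lt_compat].
  - eapply Rle_trans; [|apply inv_cosh_le_exp].
    apply Rmult_le_reg_r with (cosh t * (cosh t * cosh w + 1)); [nra|].
    replace (sinh w * / (cosh t * cosh w + 1) * (cosh t * (cosh t * cosh w + 1)))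
      with (sinh w * cosh t) by (field; lra).
    replace (/ cosh t * (cosh t * (cosh t * cosh w + 1))) with (cosh t * cosh w + 1)
      by (field; lra). nra.
Qed.

Lemma incomplete_gamma_error a : exists C, 0 <= C /\ forall x T, 1 <= x -> 0 <= T ->
  Rabs (RInt (fun t => divpow a t * exp (- x * t)) 0 T - / x ^ S a) <= C * exp (- T / 2).
Proof.
  destruct (Rsum_bounded (fun T => 0 <= T) divpow (fun T => exp (T / 2)) (seq 0 (S a)))
    as [C [HC0 HC]].
  { intros j _; exists (2 ^ j); split; [apply pow_le; lra|apply divpow_le_exp_half]. }
  exists C; split; [assumption|intros x T Hx HT].
  set (c := fun n => / x ^ S n). set (delta := fun n => match n with O => 1 | S _ => 0 end).
  assert (Hder : forall t, is_derive (fun t => - (exp (- x * t) * exp_conv c a t)) t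
    (divpow a t * exp (- x * t))).
  { intros t; rewrite <- (exp_conv_delta delta) by reflexivity. evar_last.
    - apply (is_derive_opp (fun t => exp (- x * t) * exp_conv c a t)).
      apply (is_derive_exp_mult_exp_conv x c delta); unfold c, delta; simpl; [field; lra|].
      intros n; field; split; [apply pow_nonzero|]; lra.
    - unfold opp; simpl; ring. }
  erewrite RInt_of_is_derive; [|auto 10 with continuity|exact Hder].
  cbv beta; rewrite exp_conv_at_0, Rmult_0_r, exp_0.
  replace (- (exp (- x * T) * exp_conv c a T) - - (1 * c a) - / x ^ S a)
    with (- (exp (- x * T) * exp_conv c a T)) by (unfold c; ring).
  assert (Hc : forall n, 0 <= c n <= 1).
  { intros n; unfold c; assert (Hpow := pow_R1_Rle x (S n) Hx). split.
    - apply Rlt_le, Rinv_0_lt_compat; lra.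
    - rewrite <- Rinv_1; apply Rinv_le_contravar; lra. }
  assert (Hpoly : 0 <= exp_conv c a T <= C * exp (T / 2)).
  { split; [apply exp_conv_nonneg; [apply Hc|assumption]|].
    eapply Rle_trans; [|now apply HC]. apply Rsum_le; intros j _.
    rewrite <- Rmult_1_l; apply Rmult_le_compat_r; [now apply divpow_nonneg|apply Hc]. }
  rewrite Rabs_Ropp, Rabs_pos_eq by (apply Rmult_le_pos; [apply Rlt_le, exp_pos|apply Hpoly]).
  apply Rle_trans with (exp (- T) * (C * exp (T / 2))).
  - apply Rmult_le_compat; [apply Rlt_le, exp_pos|apply Hpoly|apply exp_le; nra|apply Hpoly].
  - right; replace (- T / 2) with (- T + T / 2) by field. rewrite exp_plus; ring.
Qed.

(** * The symmetric kernel *)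

(* Up to sign, the derivative of [poisson t w / cosh w] in [t]. *)
Definition kappa (t w : R) : R :=
  sinh t * sinh w * (/ (cosh t * cosh w + 1) * / (cosh t * cosh w + 1)).

Lemma kappa_sym t w : kappa t w = kappa w t.
Proof. unfold kappa; now rewrite (Rmult_comm (sinh t)), (Rmult_comm (cosh t)). Qed.

Lemma is_derive_poisson t w : is_derive (fun t => poisson t w) t (- (cosh w * kappa t w)).
Proof.
  assert (Hden := cosh_mult_cosh_plus_1_pos t w). evar_last.
  - apply is_derive_scal, is_derive_inv; [|lra].
    apply is_derive_Rplus; [|apply (is_derive_const 1)].
    apply is_derive_Rmult; [apply is_derive_cosh|apply (is_derive_const (cosh w))].
  - unfold kappa; change (@zero R_NormedModule) with 0; simpl; field; lra.
Qed.

Lemma continuous_kappa {U : UniformSpace} (f g : U -> R) x :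
  continuous f x -> continuous g x -> continuous (fun y => kappa (f y) (g y)) x.
Proof. intros; unfold kappa; auto 15 with continuity. Qed.

#[local] Hint Resolve continuous_kappa : continuity.

Definition kappa_transform (N a : nat) (w : R) : R :=
  RInt (fun t => divpow a t * kappa t w) 0 (INR N).

Lemma cosh_mult_kappa_transform N a w :
  cosh w * kappa_transform N (S a) w =
  RInt (fun t => divpow a t * poisson t w) 0 (INR N) - divpow (S a) (INR N) * poisson (INR N) w.
Proof.
  assert (Hftc : RInt (fun t => divpow a t * poisson t w - cosh w * (divpow (S a) t * kappa t w))
      0 (INR N) = divpow (S a) (INR N) * poisson (INR N) w - divpow (S a) 0 * poisson 0 w).
  { apply RInt_of_is_derive with (F := fun t => divpow (S a) t * poisson t w);
      [auto 10 with continuity|intros t].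
    evar_last; [apply is_derive_Rmult; [apply is_derive_divpow_S|apply is_derive_poisson]|].
    simpl; ring. }
  rewrite RInt_Rminus, RInt_Rscal, divpow_S_at_0 in Hftc by auto 10 with continuity.
  unfold kappa_transform; lra.
Qed.

Lemma unif_null_RInt_poisson_remainder a :
  unif_null (fun w => 0 <= w) (fun N w =>
    RInt (fun t => divpow a t * (poisson t w - poisson_sum N t (gd w))) 0 (INR N)).
Proof.
  exists (fun N => 2 ^ S a * 2 * / INR N); split; [apply is_lim_seq_null_scal, is_lim_seq_inv_INR|].
  exists 1%nat; intros N HN w Hw; apply (le_INR 1) in HN; simpl (INR 1) in HN.
  replace (2 ^ S a * 2 * / INR N) with (2 ^ S a / (INR N / 2)) by (field; lra).
  apply RInt_abs_le_exp; [auto 10 with continuity|lra|lra|].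
  intros t [Ht _]; rewrite Rabs_mult, Rabs_pos_eq by now apply divpow_nonneg.
  apply Rle_trans with (2 ^ a * exp (t / 2) * (2 * exp (- INR N * t))).
  - apply Rmult_le_compat; [now apply divpow_nonneg|apply Rabs_pos|now apply divpow_le_exp_half|].
    now apply Rabs_poisson_remainder_le.
  - replace (2 ^ a * exp (t / 2) * (2 * exp (- INR N * t)))
      with (2 ^ S a * exp (t / 2 + - INR N * t)) by (rewrite exp_plus; simpl; ring).
    apply Rmult_le_compat_l; [apply pow_le; lra|apply exp_le; nra].
Qed.

Lemma RInt_divpow_mult_poisson_sum N a v :
  RInt (fun t => divpow a t * poisson_sum N t v) 0 (INR N) =
  2 * \sum_(n < N) (-1) ^ n * (sin (INR (S n) * v) *
        RInt (fun t => divpow a t * exp (- INR (S n) * t)) 0 (INR N)).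
Proof.
  rewrite <- Rsum_scal, (RInt_ext _ (fun t => \sum_(n < N)
    (2 * ((-1) ^ n * sin (INR (S n) * v))) * (divpow a t * exp (- INR (S n) * t)))).
  - rewrite RInt_Rsum by auto 10 with continuity.
    apply Rsum_ext; intros n _; rewrite RInt_Rscal by auto 10 with continuity; ring.
  - intros t _; unfold poisson_sum; rewrite <- !Rsum_scal; apply Rsum_ext; intros; ring.
Qed.

Lemma unif_null_RInt_poisson_sum a :
  unif_null (fun _ => True) (fun N v =>
    RInt (fun t => divpow a t * poisson_sum N t v) 0 (INR N) - sin_sum N (S a) v).
Proof.
  destruct (incomplete_gamma_error a) as [C [HC0 HC]].
  exists (fun N => 2 * C * (INR (S N) * exp (- INR N / 2))); split;
    [apply is_lim_seq_null_scal, is_lim_seq_INR_S_exp_half|].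
  exists 0%nat; intros N _ v _.
  rewrite RInt_divpow_mult_poisson_sum; unfold sin_sum.
  rewrite <- Rmult_minus_distr_l, <- Rsum_minus, Rabs_mult, Rabs_pos_eq, Rmult_assoc by lra.
  apply Rmult_le_compat_l; [lra|]. eapply Rle_trans; [apply Rabs_Rsum_le|].
  apply Rle_trans with (\sum_(n < N) C * exp (- INR N / 2)).
  - apply Rsum_le; intros n _.
    replace ((-1) ^ n * (sin (INR (S n) * v) *
        RInt (fun t => divpow a t * exp (- INR (S n) * t)) 0 (INR N)) -
        (-1) ^ n * (sin (INR (S n) * v) / INR (S n) ^ S a))
      with ((-1) ^ n * (sin (INR (S n) * v) *
        (RInt (fun t => divpow a t * exp (- INR (S n) * t)) 0 (INR N) - / INR (S n) ^ S a)))
      by (unfold Rdiv; ring).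
    rewrite !Rabs_mult, pow_1_abs, Rmult_1_l, <- (Rmult_1_l (C * _)).
    apply Rmult_le_compat; [apply Rabs_pos|apply Rabs_pos|apply Rabs_sin_le_1|].
    apply HC; [apply one_le_INR_S|apply pos_INR].
  - rewrite Rsum_const, S_INR. assert (He := exp_pos (- INR N / 2)). nra.
Qed.

Lemma unif_null_divpow_mult_poisson_at_INR a :
  unif_null (fun w => 0 <= w) (fun N w => divpow a (INR N) * poisson (INR N) w).
Proof.
  exists (fun N => 2 ^ S a * (INR (S N) * exp (- INR N / 2))); split;
    [apply is_lim_seq_null_scal, is_lim_seq_INR_S_exp_half|].
  exists 0%nat; intros N _ w Hw; assert (HN := pos_INR N).
  destruct (poisson_bounds (INR N) w Hw) as [Hp0 Hp]; assert (Hd := divpow_nonneg a (INR N) HN).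
  rewrite Rabs_pos_eq by now apply Rmult_le_pos.
  apply Rle_trans with (2 ^ a * exp (INR N / 2) * (2 * exp (- INR N))).
  - apply Rmult_le_compat; [assumption|assumption|now apply divpow_le_exp_half|assumption].
  - replace (2 ^ a * exp (INR N / 2) * (2 * exp (- INR N))) with (2 ^ S a * exp (- INR N / 2)).
    + apply Rmult_le_compat_l; [apply pow_le; lra|].
      assert (He := exp_pos (- INR N / 2)); rewrite S_INR; nra.
    + replace (- INR N / 2) with (INR N / 2 + - INR N) by field. rewrite exp_plus; simpl; ring.
Qed.

Lemma unif_null_kappa_transform a :
  unif_null (fun w => 0 <= w) (fun N w =>
    cosh w * kappa_transform N (S a) w - sin_sum N (S a) (gd w)).
Proof.
  apply unif_null_ext with (fun N w =>
    RInt (fun t => divpow a t * (poisson t w - poisson_sum N t (gd w))) 0 (INR N) +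
    (RInt (fun t => divpow a t * poisson_sum N t (gd w)) 0 (INR N) - sin_sum N (S a) (gd w)) +
    -1 * (divpow (S a) (INR N) * poisson (INR N) w)).
  - intros N w _; rewrite cosh_mult_kappa_transform.
    rewrite (RInt_ext (fun t => divpow a t * (poisson t w - poisson_sum N t (gd w)))
      (fun t => divpow a t * poisson t w - divpow a t * poisson_sum N t (gd w)))
      by (intros; simpl; ring).
    rewrite RInt_Rminus by auto 10 with continuity; ring.
  - apply unif_null_plus; [apply unif_null_plus|].
    + apply unif_null_RInt_poisson_remainder.
    + exact (unif_null_comp _ _ gd _ (fun _ _ => I) (unif_null_RInt_poisson_sum a)).
    + apply unif_null_scal, unif_null_divpow_mult_poisson_at_INR.
Qed.

Definition kappa_combination (m N : nat) (w : R) : R :=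
  \sum_(i < S m) zcoef (m - i) * kappa_transform N (2 * i + 1) w.

Lemma unif_null_kappa_combination m :
  unif_null (fun w => 0 <= w) (fun N w =>
    (-1) ^ m * divpow (2 * m + 1) (gd w) - cosh w * kappa_combination m N w).
Proof.
  apply unif_null_ext with (fun N w => -1 * odd_power_error m N (gd w) +
    -1 * \sum_(i < S m) zcoef (m - i) *
      (cosh w * kappa_transform N (S (2 * i)) w - sin_sum N (S (2 * i)) (gd w))).
  - intros N w _; unfold odd_power_error, kappa_combination; rewrite <- (Rsum_scal (cosh w)).
    rewrite (Rsum_ext (fun i => zcoef (m - i) * (_ - _)) (fun i =>
      cosh w * (zcoef (m - i) * kappa_transform N (2 * i + 1) w) -
      zcoef (m - i) * sin_sum N (2 * i + 1) (gd w))) by (intros i _; rewrite Nat.add_1_r; ring).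
    rewrite Rsum_minus; ring.
  - apply unif_null_plus; apply unif_null_scal.
    + exact (unif_null_comp _ _ gd _ gd_bounds (unif_null_odd_power_error m)).
    + apply unif_null_Rsum; intros i _; apply unif_null_scal, unif_null_kappa_transform.
Qed.

(** * Symmetry of the moments *)

Definition kappa_moment (N a b : nat) : R :=
  RInt (fun w => divpow a w * kappa_transform N b w) 0 (INR N).

Lemma kappa_moment_sym N a b : kappa_moment N a b = kappa_moment N b a.
Proof.
  set (f := fun a b w t => divpow a w * (divpow b t * kappa t w)).
  assert (Hmoment : forall a b,
    kappa_moment N a b = RInt (fun w => RInt (f a b w) 0 (INR N)) 0 (INR N)).
  { intros a' b'; apply RInt_ext; intros w _; unfold f, kappa_transform; symmetry.
    apply RInt_Rscal; auto 10 with continuity. }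
  rewrite !Hmoment, RInt_fubini.
  - apply RInt_ext; intros t _; apply RInt_ext; intros w _.
    unfold f; rewrite kappa_sym; simpl; ring.
  - intros w t; unfold f; auto 10 with continuity.
Qed.

Lemma is_lim_seq_RInt_unif_null (g : R -> R) D K lam : 0 < lam ->
  (forall w, continuous g w) -> (forall N w, continuous (D N) w) ->
  (forall w, 0 <= w -> Rabs (g w) <= K * exp (- lam * w)) ->
  unif_null (fun w => 0 <= w) D ->
  is_lim_seq (fun N => RInt (fun w => g w * D N w) 0 (INR N)) 0.
Proof.
  intros Hlam Hg HD HK [e [He HDe]].
  apply is_lim_seq_null_le with (fun N => K / lam * e N); [|now apply is_lim_seq_null_scal].
  revert HDe; apply filter_imp; intros N HDe.
  replace (K / lam * e N) with (K * e N / lam) by (field; lra).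
  apply RInt_abs_le_exp; [intros; now apply continuous_Rmult|assumption|apply pos_INR|].
  intros w [Hw _]; rewrite Rabs_mult.
  replace (K * e N * exp (- lam * w)) with (K * exp (- lam * w) * e N) by ring.
  apply Rmult_le_compat; [apply Rabs_pos|apply Rabs_pos|now apply HK|now apply HDe].
Qed.

Lemma continuous_kappa_transform N a w : continuous (kappa_transform N a) w.
Proof.
  apply (continuous_RInt_param (fun w t => divpow a t * kappa t w)).
  intros x t; auto 10 with continuity.
Qed.

#[local] Hint Resolve continuous_kappa_transform : continuity.

Lemma continuous_kappa_combination m N w : continuous (kappa_combination m N) w.
Proof. unfold kappa_combination; auto 10 with continuity. Qed.

#[local] Hint Resolve continuous_kappa_combination : continuity.

Lemma RInt_divpow_mult_kappa_combination m N a :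
  RInt (fun w => divpow a w * kappa_combination m N w) 0 (INR N) =
  \sum_(i < S m) zcoef (m - i) * kappa_moment N a (2 * i + 1).
Proof.
  rewrite (RInt_ext _ (fun w => \sum_(i < S m)
    zcoef (m - i) * (divpow a w * kappa_transform N (2 * i + 1) w))).
  - rewrite RInt_Rsum by auto 10 with continuity.
    apply Rsum_ext; intros i _; apply RInt_Rscal; auto 10 with continuity.
  - intros w _; unfold kappa_combination; rewrite <- Rsum_scal; apply Rsum_ext; intros; ring.
Qed.

Lemma is_lim_seq_kappa_moments_W m a :
  is_lim_seq (fun N => \sum_(i < S m) zcoef (m - i) * kappa_moment N a (2 * i + 1))
    ((-1) ^ m * W (a + 2 * S m) (2 * S m)).
Proof.
  set (g := fun w => / cosh w * divpow a w).
  assert (Hg : forall w, 0 <= w -> Rabs (g w) <= 2 ^ S a * exp (- / 2 * w)).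
  { intros w Hw; assert (Hd := divpow_nonneg a w Hw); assert (Hc := inv_cosh_pos w).
    unfold g; rewrite Rabs_pos_eq by nra.
    apply Rle_trans with (2 * exp (- w) * (2 ^ a * exp (w / 2))).
    - apply Rmult_le_compat; [lra|assumption|apply inv_cosh_le_exp|now apply divpow_le_exp_half].
    - right; replace (- / 2 * w) with (- w + w / 2) by field. rewrite exp_plus; simpl; ring. }
  assert (Hcont : forall w, continuous g w) by (unfold g; auto 10 with continuity).
  set (err := fun N w =>
    (-1) ^ m * divpow (2 * m + 1) (gd w) - cosh w * kappa_combination m N w).
  assert (Herrcont : forall N w, continuous (err N) w)
    by (intros; unfold err; auto 10 with continuity).
  assert (Herr := is_lim_seq_RInt_unif_null g err _ (/ 2) ltac:(lra) Hcont Herrcont Hg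
    (unif_null_kappa_combination m)).
  assert (HW := is_lim_seq_RInt_W a (2 * m + 1)).
  replace (S (2 * m + 1)) with (2 * S m)%nat in HW by lia.
  assert (Hlim := is_lim_seq_minus' _ _ _ _ (is_lim_seq_scal_l _ ((-1) ^ m) _ HW) Herr).
  rewrite Rminus_0_r in Hlim; eapply is_lim_seq_ext; [|exact Hlim].
  intros N; cbv beta; rewrite pow_1_even, Rmult_1_l.
  rewrite <- RInt_Rscal, <- RInt_Rminus, <- RInt_divpow_mult_kappa_combination
    by (unfold g; auto 15 with continuity).
  apply RInt_ext; intros w _; assert (Hc := cosh_pos w). unfold g, err; simpl; field; lra.
Qed.

Definition moment_sum (N m p : nat) : R :=
  \sum_(j < S p) zcoef (p - j) *
    \sum_(i < S m) zcoef (m - i) * kappa_moment N (2 * j + 1) (2 * i + 1).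

Lemma moment_sum_sym N m p : moment_sum N m p = moment_sum N p m.
Proof.
  unfold moment_sum.
  transitivity (\sum_(j < S p) \sum_(i < S m)
    zcoef (p - j) * (zcoef (m - i) * kappa_moment N (2 * j + 1) (2 * i + 1))).
  - apply Rsum_ext; intros j _; now rewrite Rsum_scal.
  - rewrite Rsum_exchange; apply Rsum_ext; intros i _; rewrite <- Rsum_scal.
    apply Rsum_ext; intros j _; rewrite kappa_moment_sym; ring.
Qed.

Lemma is_lim_seq_moment_sum m p :
  is_lim_seq (fun N => moment_sum N m p)
    (- ((-1) ^ S m * \sum_(j <- seq 1 (S p)) W (2 * j + 2 * S m - 1) (2 * S m) * Zjp j (S p))).
Proof.
  replace (- ((-1) ^ S m * \sum_(j <- seq 1 (S p)) W (2 * j + 2 * S m - 1) (2 * S m) * Zjp j (S p)))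
    with (\sum_(j < S p) zcoef (p - j) * ((-1) ^ m * W (2 * j + 1 + 2 * S m) (2 * S m))).
  - apply (is_lim_seq_Rsum (fun j N => zcoef (p - j) *
      \sum_(i < S m) zcoef (m - i) * kappa_moment N (2 * j + 1) (2 * i + 1))); intros j _.
    apply (is_lim_seq_scal_l _ (zcoef (p - j))
      ((-1) ^ m * W (2 * j + 1 + 2 * S m) (2 * S m))), is_lim_seq_kappa_moments_W.
  - rewrite (Rsum_seq _ 1), Ropp_mult_distr_l, <- Rsum_scal; apply Rsum_ext_lt; intros j Hj.
    rewrite (Zjp_zcoef (1 + j)) by lia.
    replace (S p - (1 + j))%nat with (p - j)%nat by lia.
    replace (2 * (1 + j) + 2 * S m - 1)%nat with (2 * j + 1 + 2 * S m)%nat by lia.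
    rewrite <- tech_pow_Rmult; ring.
Qed.

Theorem theorem1p1 : forall m p : nat, (1 <= m)%nat -> (1 <= p)%nat ->
  (-1) ^ m * Rsum_list (map (fun j => W (2 * j + 2 * m - 1) (2 * m) * Zjp j p) (seq 1 p))
  = (-1) ^ p * Rsum_list (map (fun j => W (2 * j + 2 * p - 1) (2 * p) * Zjp j m) (seq 1 m)).
Proof.
  intros [|m] [|p] Hm Hp; try lia.
  assert (Hmp := is_lim_seq_unique _ _ (is_lim_seq_moment_sum m p)).
  assert (Hpm := is_lim_seq_unique _ _ (is_lim_seq_moment_sum p m)).
  rewrite (Lim_seq_ext _ _ (fun N => moment_sum_sym N m p)), Hpm in Hmp.
  apply Rbar_finite_eq in Hmp; lra.
Qed.
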